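(* Let $f\in C(\Omega)\cap L^\infty(\Omega)$ and $g\in C(\partial\Omega)$. Assume that the boundary-value problem $$-\Delta_\infty u=f\ \text{ in }\Omega,\qquad u=g\ \text{ on }\partial\Omega$$ has a unique viscosity solution $u\in C(\bar\Omega)$. For each $\varepsilon>0$ let $\bar u_\varepsilon,\underline u_\varepsilon\in C(\bar\Omega)$ denote the maximal and minimal solutions, respectively, of the finite difference problem $$-\Delta^\varepsilon_\infty w=f\ \text{ in }\Omega,\qquad w=g\ \text{ on }\partial\Omega.$$ Then $\bar u_\varepsilon\to u$ and $\underline u_\varepsilon\to u$ uniformly on $\bar\Omega$ as $\varepsilon\to0$.
   Context: $\Omega\subseteq\mathbb{R}^n$ is a bounded, connected, open set. For $x,y\in\bar\Omega$, $d(x,y)$ is the path distance: the infimum of the lengths of Lipschitz paths $\gamma:[0,1]\to\bar\Omega$ with $\gamma(0)=x$, $\gamma(1)=y$. It is assumed that $\operatorname{diam}(\Omega):=\sup\{d(x,y):x,y\in\bar\Omega\}<\infty$. Write $\bar\Omega(x,r):=\{y\in\bar\Omega: d(x,y)\le r\}$. For $\varepsilon>0$ set $\rho_\varepsilon(x,y):=\max\{d(x,y),\varepsilon\}$ if $x,y\in\Omega$, and $\rho_\varepsilon(x,y):=d(x,y)$ if $x\in\partial\Omega$ or $y\in\partial\Omega$. For $w:\bar\Omega\to\mathbb{R}$ and $x\in\Omega$, $$S^+_\varepsilon w(x):=\sup_{y\in\bar\Omega(x,\varepsilon)}\frac{w(y)-w(x)}{\rho_\varepsilon(x,y)},\quad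 S^-_\varepsilon w(x):=\sup_{y\in\bar\Omega(x,\varepsilon)}\frac{w(x)-w(y)}{\rho_\varepsilon(x,y)},\quad \Delta^\varepsilon_\infty w(x):=\frac1\varepsilon\big(S^+_\varepsilon w(x)-S^-_\varepsilon w(x)\big),$$ and the finite difference equation is understood pointwise. The maximal solution $\bar u_\varepsilon$ (minimal solution $\underline u_\varepsilon$) is the solution in $C(\bar\Omega)$ with the property that every bounded $w:\bar\Omega\to\mathbb{R}$ with $-\Delta_\infty^\varepsilon w\le f$ ($\ge f$) in $\Omega$ and $w\le g$ ($\ge g$) on $\partial\Omega$ satisfies $w\le\bar u_\varepsilon$ ($w\ge\underline u_\varepsilon$) on $\bar\Omega$; such solutions exist. For a $C^2$ function $\varphi$ near $x$: if $D\varphi(x)\ne0$, $\Delta_\infty^+\varphi(x)=\Delta_\infty^-\varphi(x):=|D\varphi(x)|^{-2}\langle D^2\varphi(x)D\varphi(x),D\varphi(x)\rangle$; if $D\varphi(x)=0$, $\Delta_\infty^+\varphi(x):=\max_{|v|=1}\langle D^2\varphi(x)v,v\rangle$ and $\Delta_\infty^-\varphi(x):=\min_{|v|=1}\langle D^2\varphi(x)v,v\rangle$. A continuous $u$ is a viscosity solution of $-\Delta_\infty u=f$ in $\Omega$ if for every polynomial $\varphi$ of degree 2 (at most) and $x_0\in\Omega$: $-\Delta_\infty^+\varphi(x_0)\le f(x_0)$ whenever $u-\varphi$ has a strict local maximum at $x_0$, and $-\Delta_\infty^-\varphi(x_0)\ge f(x_0)$ whenever $u-\varphi$ has a strict local minimum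 at $x_0$. *)

(* Defs.v *)
From HB Require Import structures.
From mathcomp Require Import all_boot all_order all_algebra.
From mathcomp Require Import all_classical all_reals all_analysis.
Set Implicit Arguments.
Unset Strict Implicit.
Unset Printing Implicit Defensive.
Import Order.TTheory GRing.Theory Num.Theory.
Import numFieldNormedType.Exports.
Local Open Scope classical_set_scope.
Local Open Scope ring_scope.

(* Functions on Omega, its boundary or its closure are represented by total
   functions on 'rV[R]_n.+1; their values elsewhere are never used. *)

Section Euclidean.
Context {R : realType} {n : nat}.
Implicit Types u v : 'rV[R]_n.+1.

Definition dotv u v : R := \sum_i u 0 i * v 0 i.

(* The library norm `|v| on row vectors is the maximum norm; it induces the
   same topology, bounded sets and Lipschitz maps, but not the same lengths. *)
Definition enorm v : R := Num.sqrt (dotv v v).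

Definition boundary (Omega : set 'rV[R]_n.+1) : set 'rV[R]_n.+1 :=
  closure Omega `\` interior Omega.

End Euclidean.

Section PathDistance.
Context {R : realType} {n : nat}.
Implicit Types (gamma : R -> 'rV[R]_n.+1) (Omega : set 'rV[R]_n.+1).
Implicit Types x y : 'rV[R]_n.+1.

(* Vector-valued analogue of the library's [variation] and
   [total_variation]. *)
Definition path_variation (a b : R) gamma (s : seq R) : R :=
  let F := gamma \o nth b (a :: s) in
  \sum_(0 <= k < size s) enorm (F k.+1 - F k).

Definition path_length gamma : \bar R :=
  ereal_sup [set (path_variation 0 1 gamma s)%:E | s in itv_partition 0 1].

Definition admissible_path Omega x y gamma : Prop :=
  [/\ [lipschitz gamma t | t in `[0, 1]],
      gamma @` `[0, 1] `<=` closure Omega,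
      gamma 0 = x & gamma 1 = y].

Definition path_dist Omega x y : \bar R :=
  ereal_inf [set path_length gamma | gamma in admissible_path Omega x y].

Definition path_diam Omega : \bar R :=
  ereal_sup [set path_dist Omega z.1 z.2 |
             z in closure Omega `*` closure Omega].

Definition path_ball Omega x (r : R) : set 'rV[R]_n.+1 :=
  [set y | closure Omega y /\ (path_dist Omega x y <= r%:E)%E].

End PathDistance.

Section FiniteDifference.
Context {R : realType} {n : nat}.
Variable Omega : set 'rV[R]_n.+1.
Implicit Types (eps : R) (w f g : 'rV[R]_n.+1 -> R) (x y : 'rV[R]_n.+1).

(* [fine] is harmless: the distance is finite when [path_diam Omega] is. *)
Definition rho eps x y : R :=
  let d := fine (path_dist Omega x y) in
  if (x \in Omega) && (y \in Omega) then Num.max d eps else d.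

(* For w bounded on the closure of Omega and x in Omega these are suprema of
   nonempty bounded sets of reals: y = x contributes 0, and rho eps x y is
   bounded away from 0 in y. *)
Definition Splus eps w x : R :=
  sup [set (w y - w x) / rho eps x y | y in path_ball Omega x eps].

Definition Sminus eps w x : R :=
  sup [set (w x - w y) / rho eps x y | y in path_ball Omega x eps].

Definition fd_inf_laplacian eps w x : R :=
  eps^-1 * (Splus eps w x - Sminus eps w x).

Definition fd_solution eps f g w : Prop :=
  [/\ {within closure Omega, continuous w},
      forall x, Omega x -> - fd_inf_laplacian eps w x = f x &
      forall x, boundary Omega x -> w x = g x].

Definition fd_subsolution eps f g w : Prop :=
  [/\ [bounded w x | x in closure Omega],
      forall x, Omega x -> - fd_inf_laplacian eps w x <= f x &
      forall x, boundary Omega x -> w x <= g x].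

Definition fd_supersolution eps f g w : Prop :=
  [/\ [bounded w x | x in closure Omega],
      forall x, Omega x -> - fd_inf_laplacian eps w x >= f x &
      forall x, boundary Omega x -> w x >= g x].

Definition fd_maximal_solution eps f g w : Prop :=
  fd_solution eps f g w /\
  forall v, fd_subsolution eps f g v ->
    forall x, closure Omega x -> v x <= w x.

Definition fd_minimal_solution eps f g w : Prop :=
  fd_solution eps f g w /\
  forall v, fd_supersolution eps f g v ->
    forall x, closure Omega x -> w x <= v x.

End FiniteDifference.

Section Viscosity.
Context {R : realType} {n : nat}.
Implicit Types (phi u f g : 'rV[R]_n.+1 -> R) (x v : 'rV[R]_n.+1).
Implicit Types Omega : set 'rV[R]_n.+1.

Definition basis_vec (i : 'I_n.+1) : 'rV[R]_n.+1 := delta_mx 0 i.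

Definition gradient phi x : 'rV[R]_n.+1 := \row_i 'D_(basis_vec i) phi x.

Definition hessian phi x : 'M[R]_n.+1 :=
  \matrix_(i, j) 'D_(basis_vec i) (fun y => 'D_(basis_vec j) phi y) x.

Definition hess_form phi x v : R := dotv (v *m hessian phi x) v.

(* The extrema over the unit sphere are attained, so [sup] and [inf] are the
   maximum and the minimum. *)
Definition inf_laplacian_plus phi x : R :=
  let p := gradient phi x in
  if p != 0 then (enorm p ^+ 2)^-1 * hess_form phi x p
  else sup [set hess_form phi x v | v in [set v | enorm v = 1]].

Definition inf_laplacian_minus phi x : R :=
  let p := gradient phi x in
  if p != 0 then (enorm p ^+ 2)^-1 * hess_form phi x p
  else inf [set hess_form phi x v | v in [set v | enorm v = 1]].

Definition poly_deg_le2 phi : Prop :=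
  exists (c : R) (b : 'rV[R]_n.+1) (A : 'M[R]_n.+1),
    forall x, phi x = c + \sum_i b 0 i * x 0 i
                        + \sum_i \sum_j A i j * x 0 i * x 0 j.

Definition strict_local_max (h : 'rV[R]_n.+1 -> R) x0 : Prop :=
  \forall y \near x0^', h y < h x0.

Definition strict_local_min (h : 'rV[R]_n.+1 -> R) x0 : Prop :=
  \forall y \near x0^', h x0 < h y.

Definition viscosity_solution Omega f u : Prop :=
  {within Omega, continuous u} /\
  forall phi x0, poly_deg_le2 phi -> Omega x0 ->
    (strict_local_max (u \- phi) x0 -> - inf_laplacian_plus phi x0 <= f x0) /\
    (strict_local_min (u \- phi) x0 -> - inf_laplacian_minus phi x0 >= f x0).

Definition dirichlet_viscosity_solution Omega f g u : Prop :=
  [/\ {within closure Omega, continuous u},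
      viscosity_solution Omega f u &
      forall x, boundary Omega x -> u x = g x].

End Viscosity.

(* Main.v *)
Require Import Defs.
From HB Require Import structures.
From mathcomp Require Import all_boot all_order all_algebra.
From mathcomp Require Import all_classical all_reals all_analysis.
From mathcomp Require Import ring lra.
Set Implicit Arguments.
Unset Strict Implicit.
Unset Printing Implicit Defensive.
Import Order.TTheory GRing.Theory Num.Theory.
Import numFieldNormedType.Exports.
Local Open Scope classical_set_scope.
Local Open Scope ring_scope.

(** Solutions of the scheme form a family which is bounded and equicontinuous
    up to the boundary, uniformly in small [eps], and every limit point of the
    family solves the boundary value problem; uniqueness then forces
    convergence.

    Equicontinuity at a boundary point comes from comparison with a concave
    quadratic function of the Euclidean distance to that point
    ([quadratic_barrier]). The Euclidean distance suffices because the path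
    distance dominates it and agrees with it along segments that stay in the
    closure. Such a segment may hit the boundary in fewer than [eps] units, and
    then the concavity of the barrier gains too little; raising the barrier by
    a multiple of [eps ^+ 2] in the interior compensates for this. The same
    barrier with a centre far away bounds the family.

    In the interior the equation says that the ascending slopes at scale [eps]
    lose at most [eps * M], with [M] a bound for the source, at each step of
    steepest ascent ([ascent]). A steep slope would therefore persist along a
    chain of about [1 / eps] steps and make the solution exceed its bound;
    hence increments over distance [eps] are [O(eps)] ([one_step_bound]).

    Limits are taken along an ultrafilter converging to [0] from the right, so
    that bounded quantities converge without extracting subsequences. When a
    quadratic polynomial touches the limit from above, it touches the solutions
    of the scheme from above at nearby points up to constants, and the equation
    there yields, in the limit, a vector [e] which is the normalized gradient
    if the gradient does not vanish, and along which the second derivative of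
    the polynomial is at least minus the source ([ultralimit_touching]). This is
    the viscosity inequality except at a strictly concave critical point, where
    [e] could be short; there the vertex of a paraboloid is shifted to obtain a
    contact point with nonzero gradient ([ultralimit_paraboloid]).
    Supersolutions follow by changing signs. *)

(** * Euclidean norm *)

Lemma bounded_onP (R : realType) (T : Type) (V : normedModType R) (A : set T)
    (h : T -> V) :
  [bounded h x | x in A] <-> exists M, forall x, A x -> `|h x| <= M.
Proof.
split=> [/pinfty_ex_gt0[M _ hM]|[M hM]]; first by exists M.
exists M; split; first exact: num_real.
by move=> N MN x Ax; exact: le_trans (hM x Ax) (ltW MN).
Qed.

Section EuclideanNorm.
Context {R : realType} {n : nat}.
Implicit Types u v w x y : 'rV[R]_n.+1.

Lemma dotvC u v : dotv u v = dotv v u.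
Proof. by apply: eq_bigr => i _; rewrite mulrC. Qed.

Lemma dotvDl u v w : dotv (u + v) w = dotv u w + dotv v w.
Proof. by rewrite -big_split; apply: eq_bigr => i _; rewrite mxE mulrDl. Qed.

Lemma dotvZl a u v : dotv (a *: u) v = a * dotv u v.
Proof. by rewrite mulr_sumr; apply: eq_bigr => i _; rewrite mxE mulrA. Qed.

Lemma dotvDr u v w : dotv u (v + w) = dotv u v + dotv u w.
Proof. by rewrite dotvC dotvDl !(dotvC u). Qed.

Lemma dotvZr a u v : dotv u (a *: v) = a * dotv u v.
Proof. by rewrite dotvC dotvZl dotvC. Qed.

Lemma dotvNl u v : dotv (- u) v = - dotv u v.
Proof. by rewrite -scaleN1r dotvZl mulN1r. Qed.

Lemma dotvNr u v : dotv u (- v) = - dotv u v.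
Proof. by rewrite dotvC dotvNl dotvC. Qed.

Lemma dotv0l v : dotv 0 v = 0.
Proof. by rewrite -(scale0r 0) dotvZl mul0r. Qed.

Lemma dotv_ge0 v : 0 <= dotv v v.
Proof. by apply: sumr_ge0 => i _; rewrite -expr2 sqr_ge0. Qed.

Lemma enorm_ge0 v : 0 <= enorm v.
Proof. exact: sqrtr_ge0. Qed.

Lemma sqr_enorm v : enorm v ^+ 2 = dotv v v.
Proof. by rewrite sqr_sqrtr // dotv_ge0. Qed.

Lemma enormZ a v : enorm (a *: v) = `|a| * enorm v.
Proof.
by rewrite /enorm dotvZl dotvZr mulrA -expr2 sqrtrM ?sqr_ge0// sqrtr_sqr.
Qed.

Lemma enormN v : enorm (- v) = enorm v.
Proof. by rewrite /enorm dotvNl dotvNr opprK. Qed.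

Lemma enorm0 : enorm (0 : 'rV[R]_n.+1) = 0.
Proof. by rewrite /enorm dotv0l sqrtr0. Qed.

Lemma enormB x y : enorm (x - y) = enorm (y - x).
Proof. by rewrite -enormN opprB. Qed.

Lemma coord_le_enorm v i : `|v 0 i| <= enorm v.
Proof.
rewrite -sqrtr_sqr ler_wsqrtr // /dotv (bigD1 i) //= -expr2 lerDl.
by apply: sumr_ge0 => j _; rewrite -expr2 sqr_ge0.
Qed.

Lemma enorm_eq0 v : enorm v = 0 -> v = 0.
Proof.
move=> v0; apply/rowP => i; rewrite mxE; apply/eqP.
by rewrite -normr_le0 -v0 coord_le_enorm.
Qed.

Lemma enorm_gt0 v : v != 0 -> 0 < enorm v.
Proof.
move=> v0; rewrite lt_def enorm_ge0 andbT.
by apply: contra v0 => /eqP /enorm_eq0 ->.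
Qed.

(** Cauchy-Schwarz, from the nonnegativity of the square of the component of
    [u] orthogonal to [v], rescaled to avoid division. *)
Lemma dotv_le_enorm u v : dotv u v <= enorm u * enorm v.
Proof.
have [->|v0] := eqVneq v 0; first by rewrite dotvC dotv0l enorm0 mulr0.
have vp := enorm_gt0 v0.
have H : 0 <= dotv (enorm v ^+ 2 *: u - dotv u v *: v)
                   (enorm v ^+ 2 *: u - dotv u v *: v) := dotv_ge0 _.
have E : dotv (enorm v ^+ 2 *: u - dotv u v *: v)
              (enorm v ^+ 2 *: u - dotv u v *: v) =
    enorm v ^+ 2 * ((enorm u * enorm v) ^+ 2 - dotv u v ^+ 2).
  rewrite !(dotvDl, dotvDr, dotvNl, dotvNr, dotvZl, dotvZr) (dotvC v u).
  by rewrite -!sqr_enorm; ring.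
rewrite E pmulr_rge0 ?exprn_gt0// subr_ge0 in H.
have uv0 : 0 <= enorm u * enorm v by rewrite mulr_ge0 // enorm_ge0.
apply: le_trans (ler_norm _) _.
by rewrite -ler_sqr ?nnegrE // real_normK ?num_real// -subr_ge0.
Qed.

Lemma enormD u v : enorm (u + v) <= enorm u + enorm v.
Proof.
rewrite -ler_sqr ?nnegrE ?addr_ge0 ?enorm_ge0//.
rewrite sqr_enorm dotvDl !dotvDr (dotvC v u) -!sqr_enorm.
have := dotv_le_enorm u v; lra.
Qed.

Lemma enorm_triangle x y z : enorm (x - z) <= enorm (x - y) + enorm (y - z).
Proof. by have := enormD (x - y) (y - z); rewrite addrA subrK. Qed.

Lemma coord_le_norm v i : `|v 0 i| <= `|v|.
Proof.
rewrite [leRHS]/Num.norm /= mx_normrE; apply/bigmax_geP; right => /=.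
by exists (0, i).
Qed.

Lemma norm_le_enorm v : `|v| <= enorm v.
Proof.
rewrite {1}/Num.norm /= mx_normrE; apply: bigmax_le => [|[i j] _ /=].
  exact: enorm_ge0.
by rewrite ord1 coord_le_enorm.
Qed.

Lemma enorm_le_norm v : enorm v <= n.+1%:R * `|v|.
Proof.
have -> : n.+1%:R * `|v| = Num.sqrt ((n.+1%:R * `|v|) ^+ 2).
  by rewrite sqrtr_sqr ger0_norm // mulr_ge0.
apply: ler_wsqrtr; apply: (@le_trans _ _ (\sum_(i < n.+1) `|v| ^+ 2)).
  apply: ler_sum => i _; rewrite -expr2 -real_normK ?num_real//.
  by rewrite lerXn2r ?nnegrE ?normr_ge0 // coord_le_norm.
rewrite sumr_const card_ord exprMn -[leLHS]mulr_natl ler_wpM2r ?sqr_ge0 //.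
by rewrite -natrX ler_nat leq_pmulr.
Qed.

(** The topology comes from the maximum norm; this expresses it in Euclidean
    balls. *)
Lemma nbhs_enorm x (A : set 'rV[R]_n.+1) :
  nbhs x A <-> exists2 d, 0 < d & forall y, enorm (y - x) < d -> A y.
Proof.
split=> [/nbhs_normP[d /= d0 xA]|[d d0 xA]].
  exists d => // y yx; apply: xA => /=; rewrite -normrN opprB.
  exact: le_lt_trans (norm_le_enorm _) yx.
apply/nbhs_ballP; exists (d / n.+1%:R) => /=; first by rewrite divr_gt0.
move=> y; rewrite -ball_normE /=.
rewrite -normrN opprB ltr_pdivlMr // mulrC => yx; apply: xA.
exact: le_lt_trans (enorm_le_norm _) yx.
Qed.

Lemma open_enorm (A : set 'rV[R]_n.+1) x : open A -> A x ->
  exists2 d, 0 < d & forall y, enorm (y - x) <= d -> A y.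
Proof.
move=> oA Ax; have /nbhs_enorm[d d0 dA] : nbhs x A by exact: open_nbhs_nbhs.
exists (d / 2) => [|y yx]; first by rewrite divr_gt0.
by apply: dA; apply: le_lt_trans yx _; rewrite gtr_pMr // invf_lt1 // ltr1n.
Qed.

Lemma closure_enorm (A : set 'rV[R]_n.+1) x d : closure A x -> 0 < d ->
  exists2 y, A y & enorm (y - x) < d.
Proof.
move=> cA d0; have /cA[y [Ay yx]] : nbhs x [set y | enorm (y - x) < d].
  by apply/nbhs_enorm; exists d.
by exists y.
Qed.

Lemma within_continuous_enorm (A : set 'rV[R]_n.+1) (h : 'rV[R]_n.+1 -> R) :
  {within A, continuous h} <->
  forall x, A x -> forall e, 0 < e -> exists2 d, 0 < d &
    forall y, A y -> enorm (y - x) < d -> `|h y - h x| < e.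
Proof.
split=> [/subspace_continuousP hc x Ax e e0|hc].
  have /cvgrPdist_lt/(_ e e0) := hc x Ax.
  rewrite /within /= near_withinE => /nbhs_enorm[d d0 xd].
  by exists d => // y Ay yx; rewrite distrC; exact: xd.
apply/subspace_continuousP => x Ax; apply/cvgrPdist_lt => e e0.
have [d d0 xd] := hc x Ax e e0; rewrite near_withinE; apply/nbhs_enorm.
by exists d => // y yx Ay; rewrite distrC; exact: xd.
Qed.

Lemma continuous_at_enorm (h : 'rV[R]_n.+1 -> R) x :
  {for x, continuous h} <-> forall e, 0 < e -> exists2 d, 0 < d &
    forall y, enorm (y - x) < d -> `|h y - h x| < e.
Proof.
have E : {for x, continuous h} <->
    forall e, 0 < e -> nbhs x [set y | `|h x - h y| < e].
  by split=> [/cvgrPdist_lt//|H]; apply/(@cvgrPdist_lt _ _ _ (nbhs x)).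
apply: iff_trans E _; split=> H e /H.
  by move=> /nbhs_enorm[d d0 xd]; exists d => // y /xd; rewrite /= distrC.
move=> [d d0 xd]; apply/nbhs_enorm; exists d => // y /xd.
by rewrite /= distrC.
Qed.

Lemma enorm_dist_le x y : `|enorm x - enorm y| <= enorm (x - y).
Proof.
rewrite ler_distl; apply/andP; split.
  by have := enorm_triangle y x 0; rewrite !subr0 enormB; lra.
by have := enorm_triangle x y 0; rewrite !subr0; lra.
Qed.

Lemma continuous_enorm_dist z : continuous (fun x => enorm (x - z)).
Proof.
move=> x; apply/continuous_at_enorm => e e0; exists e => // y yx.
apply: le_lt_trans (enorm_dist_le _ _) _.
by rewrite opprB addrA subrK.
Qed.

Lemma compact_enorm_ball x r : compact [set y | enorm (y - x) <= r].
Proof.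
apply: bounded_closed_compact.
  apply/bounded_onP; exists (r + `|x|) => y /= yx.
  rewrite -(subrK x y); apply: le_trans (ler_normD _ _) _; rewrite lerD2r.
  exact: le_trans (norm_le_enorm _) yx.
apply: (@closed_comp _ _ (fun y => enorm (y - x)) [set t | t <= r]).
  by move=> y _; exact: continuous_enorm_dist.
exact: closed_le.
Qed.

End EuclideanNorm.

(** * Path distance *)

Section PathDistance.
Context {R : realType} {n : nat}.
Implicit Types (Omega : set 'rV[R]_n.+1) (x y : 'rV[R]_n.+1).

Lemma enorm_le_path_dist Omega x y :
  ((enorm (y - x))%:E <= path_dist Omega x y)%E.
Proof.
apply: le_ereal_inf_tmp => _ [gamma [_ _ g0 g1] <-].
apply: ereal_sup_ubound; exists [:: 1]; first exact: itv_partition1.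
by rewrite /path_variation big_nat1 /= g0 g1.
Qed.

(** The variation of an affine path over a partition telescopes. *)
Lemma path_dist_segment Omega x y :
  (forall t, 0 <= t <= 1 -> closure Omega (x + t *: (y - x))) ->
  path_dist Omega x y = (enorm (y - x))%:E.
Proof.
move=> xy; apply/eqP; rewrite eq_le enorm_le_path_dist andbT.
apply: (@le_trans _ _ (path_length (fun t : R => x + t *: (y - x)))).
  apply: ereal_inf_lbound; exists (fun t : R => x + t *: (y - x)) => //; split.
  - exists `|y - x|; split; first exact: num_real.
    move=> M yxM [s t] _ /=.
    rewrite opprD addrACA subrr add0r -scalerBl normrZ mulrC.
    by rewrite ler_wpM2r // ltW.
  - by move=> _ [t + <-]; rewrite /= in_itv /=; exact: xy.
  - by rewrite scale0r addr0.
  - by rewrite scale1r addrC subrK.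
apply: ge_ereal_sup => _ [s s01 <-]; rewrite lee_fin /path_variation /=.
pose F := nth (1 : R) (0 :: s).
have F_nd k : (k < size s)%N -> F k <= F k.+1.
  by apply: (@nondecreasing_fun_itv_partition _ _ 0 1 id s _ s01).
rewrite (eq_big_nat _ _ (F2 := fun k => (F k.+1 - F k) * enorm (y - x))).
  rewrite -mulr_suml telescope_sumr // /F (itv_partition_nth_size _ s01) /=.
  by rewrite subr0 mul1r.
move=> k /= ks; rewrite opprD addrACA subrr add0r -scalerBl enormZ ger0_norm//.
by rewrite subr_ge0; exact: F_nd.
Qed.

Lemma path_dist_refl Omega x : closure Omega x -> path_dist Omega x x = 0%E.
Proof.
move=> cx; rewrite path_dist_segment ?subrr ?enorm0// => t _.
by rewrite scaler0 addr0.
Qed.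

Lemma path_ball_enorm Omega x r y : path_ball Omega x r y ->
  [/\ closure Omega y, enorm (y - x) <= fine (path_dist Omega x y) &
      fine (path_dist Omega x y) <= r].
Proof.
move=> [cy]; have := enorm_le_path_dist Omega x y.
by case: path_dist => [d| |] //=; rewrite !lee_fin.
Qed.

Lemma closed_enorm_ball_segment x y z r t : enorm (y - x) <= r ->
  enorm (z - x) <= r -> 0 <= t <= 1 -> enorm (y + t *: (z - y) - x) <= r.
Proof.
move=> yx zx /andP[t0 t1].
have -> : y + t *: (z - y) - x = (1 - t) *: (y - x) + t *: (z - x).
  apply/rowP => i; rewrite !mxE; ring.
apply: le_trans (enormD _ _) _; rewrite !enormZ !ger0_norm ?subr_ge0//.
have t1' : 0 <= 1 - t by rewrite subr_ge0.
have := ler_wpM2l t0 zx; have := ler_wpM2l t1' yx.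
by lra.
Qed.

(** With [r] the scale of the scheme, this makes the scheme purely Euclidean at
    points farther than [r] from the boundary. *)
Lemma path_ball_interior Omega x r y : 0 <= r ->
  (forall z, enorm (z - x) <= r -> Omega z) ->
  enorm (y - x) <= r ->
  path_dist Omega x y = (enorm (y - x))%:E /\ path_ball Omega x r y.
Proof.
move=> r0 xr yx.
have E : path_dist Omega x y = (enorm (y - x))%:E.
  apply: path_dist_segment => t t01; apply: subset_closure; apply: xr.
  by apply: closed_enorm_ball_segment => //; rewrite subrr enorm0.
split=> //; split; first by apply: subset_closure; exact: xr.
by rewrite E lee_fin.
Qed.

(** The exit time is the infimum of the times spent outside the open domain,
    and this infimum is attained. *)
Lemma ray_exit Omega x e s : open Omega -> Omega x -> 0 <= s ->
  ~ Omega (x + s *: e) ->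
  exists s0, [/\ 0 < s0, s0 <= s, boundary Omega (x + s0 *: e) &
    forall t, 0 <= t < s0 -> Omega (x + t *: e)].
Proof.
move=> oO Ox s0 xs.
pose E := [set t | 0 <= t /\ ~ Omega (x + t *: e)].
have Es : E s by [].
have infE : has_inf E by split; [exists s|exists 0 => t []].
have inf0 : 0 <= inf E by apply: lb_le_inf; [exists s|move=> t []].
have bef t : 0 <= t < inf E -> Omega (x + t *: e).
  move=> /andP[t0 tE]; apply: contrapT => nO.
  by have := ge_inf infE.2 (conj t0 nO : E t); rewrite leNgt tE.
have near_ray t d : 0 < d -> exists2 a, 0 < a & forall t', `|t' - t| < a ->
    enorm (x + t' *: e - (x + t *: e)) <= d.
  move=> d0; have e0 : 0 < enorm e + 1 by rewrite ltr_wpDl // enorm_ge0.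
  exists (d / (enorm e + 1)) => [|t']; first by rewrite divr_gt0.
  rewrite ltr_pdivlMr // opprD addrACA subrr add0r -scalerBl enormZ.
  by have := normr_ge0 (t' - t); lra.
have nOE : ~ Omega (x + inf E *: e).
  move=> /(open_enorm oO)[d d0 dO].
  have [a a0 aO] := near_ray (inf E) d d0.
  have [t Et tE] := inf_adherent a0 infE; have Et' := ge_inf infE.2 Et.
  apply: Et.2; apply: dO; apply: aO.
  by rewrite ger0_norm ?subr_ge0 ?ltrBlDl.
have lt0 : 0 < inf E.
  rewrite lt_def inf0 andbT; apply/eqP => E0; apply: nOE.
  by rewrite E0 scale0r addr0.
have infs : inf E <= s by apply: (ge_inf infE.2).
exists (inf E); split=> //.
split; last by move=> /interior_subset.
move=> B /nbhs_enorm[d d0 dB].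
have [a a0 aO] := near_ray (inf E) (d / 2) ltac:(by rewrite divr_gt0).
pose m := Num.min (a / 2) (inf E).
have m0 : 0 < m by rewrite lt_min lt0 divr_gt0.
have ma : m <= a / 2 by rewrite ge_min lexx.
have mE : m <= inf E by rewrite ge_min lexx orbT.
exists (x + (inf E - m) *: e); split; first by apply: bef; lra.
apply: dB; apply: (@le_lt_trans _ _ (d / 2)); last by lra.
apply: aO; rewrite addrAC subrr add0r normrN gtr0_norm//; lra.
Qed.

Lemma closure_inside_or_boundary Omega x : open Omega ->
  closure Omega x -> Omega x \/ boundary Omega x.
Proof.
move=> oO cx; have [Ox|nOx] := pselect (Omega x); [by left|right].
by split=> //; move=> /interior_subset.
Qed.

Lemma boundary_notin Omega x : open Omega -> boundary Omega x -> ~ Omega x.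
Proof. by move=> /interior_id {2}<- []. Qed.

End PathDistance.

(** * The difference operator and its barriers *)

Section FiniteDifferenceOperator.
Context {R : realType} {n : nat}.
Variable Omega : set 'rV[R]_n.+1.
Hypothesis Omega_open : open Omega.
Hypothesis Omega_bounded : bounded_set Omega.
Implicit Types (w f g : 'rV[R]_n.+1 -> R) (x y z : 'rV[R]_n.+1).

Lemma bounded_closure : exists M, forall x, closure Omega x -> enorm x <= M.
Proof.
have [M OM] := (bounded_onP _ _).1 Omega_bounded.
exists (n.+1%:R * M + 1) => x /(closure_enorm)/(_ ltr01)[y /OM yM yx].
have := enorm_triangle x y 0; rewrite !subr0 enormB => /le_trans; apply.
rewrite addrC; apply: lerD; last exact: ltW.
by apply: le_trans (enorm_le_norm _) _; rewrite ler_wpM2l.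
Qed.

Lemma compact_closure : compact (closure Omega).
Proof.
have [M OM] := bounded_closure.
apply: bounded_closed_compact; last exact: closed_closure.
apply/bounded_onP; exists M => x /OM xM; exact: le_trans (norm_le_enorm x) xM.
Qed.

Lemma continuous_closure_bounded w : {within closure Omega, continuous w} ->
  exists C, forall x, closure Omega x -> `|w x| <= C.
Proof.
move=> cw; have /compact_bounded/bounded_onP[C wC] :
  compact (w @` closure Omega) by exact: continuous_compact compact_closure.
by exists C => x cx; apply: wC; exists x.
Qed.

(** Reduces every statement on descending slopes to ascending ones. *)
Lemma SminusE eps w : Sminus Omega eps w = Splus Omega eps (\- w).
Proof.
apply/funext => x; congr sup; apply: eq_imagel => y _ /=.
by rewrite opprK addrC.
Qed.

Lemma fd_inf_laplacianN eps w x :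
  fd_inf_laplacian Omega eps (\- w) x = - fd_inf_laplacian Omega eps w x.
Proof.
rewrite /fd_inf_laplacian !SminusE -mulrN opprB.
congr (_ * (_ - Splus _ _ _ _)).
by apply/funext => y; rewrite /= opprK.
Qed.

Lemma fd_solutionN eps f g w : fd_solution Omega eps f g w ->
  fd_solution Omega eps (\- f) (\- g) (\- w).
Proof.
move=> [cw fw gw]; split.
- by move=> x; apply: continuousN; exact: cw.
- by move=> x Ox /=; rewrite fd_inf_laplacianN fw.
- by move=> x bx /=; rewrite gw.
Qed.

Lemma rho_ge_enorm eps x y : path_ball Omega x eps y ->
  enorm (y - x) <= rho Omega eps x y.
Proof.
move=> /path_ball_enorm[_ yx _]; rewrite /rho.
by case: ifP => // _; rewrite le_max yx.
Qed.

Lemma rho_inside eps x y : path_ball Omega x eps y -> Omega x -> Omega y ->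
  rho Omega eps x y = eps.
Proof.
move=> /path_ball_enorm[_ _ yx] Ox Oy.
by rewrite /rho !mem_set //=; apply/max_idPr.
Qed.

Lemma rho_boundary eps x y : boundary Omega y ->
  rho Omega eps x y = fine (path_dist Omega x y).
Proof.
move=> /(boundary_notin Omega_open) nOy; rewrite /rho (memNset nOy).
by rewrite andbF.
Qed.

(** The denominators do not degenerate at an interior point: a boundary point
    is at a positive distance from it. *)
Lemma rho_bounded_below eps x : 0 < eps -> Omega x ->
  exists2 m, 0 < m & forall y, path_ball Omega x eps y ->
    m <= rho Omega eps x y.
Proof.
move=> e0 Ox; have [d d0 dO] := open_enorm Omega_open Ox.
exists (Num.min d eps) => [|y yb]; first by rewrite lt_min d0.
have [Oy|nOy] := pselect (Omega y).
  by rewrite (rho_inside yb) // ge_min lexx orbT.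
apply: le_trans (rho_ge_enorm yb); rewrite ge_min leNgt.
by apply/orP; left; apply/negP => yx; apply: nOy; apply: dO; exact: ltW.
Qed.

Lemma path_ball_center eps x : 0 < eps -> Omega x -> path_ball Omega x eps x.
Proof.
move=> e0 Ox; have cx := subset_closure Ox.
by split=> //; rewrite path_dist_refl // lee_fin ltW.
Qed.

Lemma Splus_ge eps w x y : 0 < eps -> {within closure Omega, continuous w} ->
  Omega x -> path_ball Omega x eps y ->
  (w y - w x) / rho Omega eps x y <= Splus Omega eps w x.
Proof.
move=> e0 /continuous_closure_bounded[C wC] Ox yb.
have [m m0 rm] := rho_bounded_below e0 Ox.
apply: ub_le_sup; last by exists y.
exists (2 * C / m) => _ [y' y'b <-].
have ry' := rm _ y'b; have ry'0 := lt_le_trans m0 ry'.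
have wyx : w y' - w x <= 2 * C.
  have := wC _ (subset_closure Ox); have [cy' _] := y'b; have := wC _ cy'.
  by rewrite !ler_norml; lra.
have C0 : 0 <= 2 * C.
  by have := wC _ (subset_closure Ox); have := normr_ge0 (w x); lra.
apply: (@le_trans _ _ (2 * C / rho Omega eps x y')).
  by rewrite ler_wpM2r // invr_ge0 ltW.
by rewrite ler_wpM2l // lef_pV2.
Qed.

Lemma Splus_le eps w x s : 0 < eps -> Omega x ->
  (forall y, path_ball Omega x eps y -> w y - w x <= s * rho Omega eps x y) ->
  Splus Omega eps w x <= s.
Proof.
move=> e0 Ox ws; have [m m0 rm] := rho_bounded_below e0 Ox.
apply: ge_sup; first by eexists; exists x; first exact: path_ball_center.
move=> _ [y yb <-]; rewrite ler_pdivrMr; first exact: ws.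
exact: lt_le_trans m0 (rm _ yb).
Qed.

Lemma Sminus_ge eps w x y : 0 < eps -> {within closure Omega, continuous w} ->
  Omega x -> path_ball Omega x eps y ->
  (w x - w y) / rho Omega eps x y <= Sminus Omega eps w x.
Proof.
move=> e0 cw Ox yb; rewrite SminusE.
have cNw : {within closure Omega, continuous (\- w)}.
  by move=> t; apply: continuousN; exact: cw.
by have := Splus_ge e0 cNw Ox yb; rewrite /= opprK [- _ + _]addrC.
Qed.

(** All the denominators are [eps], so both suprema are attained where [w] is
    extremal on the ball. *)
Lemma fd_midrange eps w x c : 0 < eps -> {within closure Omega, continuous w} ->
  (forall y, enorm (y - x) <= eps -> Omega y) ->
  - fd_inf_laplacian Omega eps w x = c ->
  exists y1 y2, [/\ enorm (y1 - x) <= eps, enorm (y2 - x) <= eps,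
    forall y, enorm (y - x) <= eps -> w y2 <= w y <= w y1 &
    2 * w x - w y1 - w y2 = eps ^+ 2 * c].
Proof.
move=> e0 cw xO wc.
have Ox : Omega x by apply: xO; rewrite subrr enorm0 ltW.
have Ob y : path_ball Omega x eps y <-> enorm (y - x) <= eps.
  split=> [/path_ball_enorm[_]|/(path_ball_interior (ltW e0) xO)[]//].
  exact: le_trans.
have rb y : enorm (y - x) <= eps -> rho Omega eps x y = eps.
  by move=> yx; apply: rho_inside => //; [exact/Ob|exact: xO].
have extr v : {within closure Omega, continuous v} -> exists2 y1,
    enorm (y1 - x) <= eps & (forall y, enorm (y - x) <= eps -> v y <= v y1) /\
    Splus Omega eps v x = (v y1 - v x) / eps.
  move=> cv.
  have [||y1 y1b y1m] := EVT_max_rV (f := v) _ (@compact_enorm_ball _ _ x eps).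
  - by exists x; rewrite /= subrr enorm0 ltW.
  - by apply: continuous_subspaceW cv => y /xO; exact: subset_closure.
  have {}y1b : enorm (y1 - x) <= eps by exact: set_mem.
  have {}y1m y : enorm (y - x) <= eps -> v y <= v y1.
    by move=> yx; apply: y1m; exact: mem_set.
  exists y1 => //; split=> //; apply/eqP; rewrite eq_le; apply/andP; split.
    apply: Splus_le => // y /Ob yx; rewrite rb // divfK ?gt_eqF//.
    by rewrite lerD2r y1m.
  by have /Ob := y1b; move=> /(Splus_ge e0 cv Ox); rewrite rb.
have [y1 y1b [y1m y1S]] := extr w cw.
have cNw : {within closure Omega, continuous (\- w)}.
  by move=> t; apply: continuousN; exact: cw.
have [y2 y2b [y2m y2S]] := extr (\- w) cNw.
exists y1, y2; split=> //.
  by move=> y yx; rewrite y1m // andbT -lerN2; exact: y2m.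
rewrite -wc /fd_inf_laplacian SminusE y1S y2S /=.
by field; rewrite gt_eqF.
Qed.

(** Let [w - q], with [q] evaluated at the distance to [z], have a maximum
    larger than the gap [K / 2 * eps ^+ 2].  There the ascending slope of [w] is
    at most the slope [s] of [q].  A step of length [eps] towards [z] makes the
    descending slope at least [s + K / 2 * eps] by concavity; if the boundary is
    met before, where [w - q] is nonpositive, the same gain comes from the gap
    divided by a distance of at most [eps].  The equation excludes this, as
    [2 * M < K]. *)
Lemma quadratic_barrier eps w M K z a b : 0 < eps ->
  {within closure Omega, continuous w} ->
  (forall x, Omega x -> - fd_inf_laplacian Omega eps w x <= M) ->
  0 <= K -> 2 * M < K -> ~ Omega z ->
  (forall x, Omega x -> K * enorm (x - z) <= b) ->
  let q t := a + b * t - K / 2 * t ^+ 2 in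
  (forall x, boundary Omega x -> w x <= q (enorm (x - z))) ->
  forall x, Omega x -> w x <= q (enorm (x - z)) + K / 2 * eps ^+ 2.
Proof.
move=> e0 cw wM K0 KM nOz bK q wq x1 Ox1; rewrite leNgt; apply/negP => x1q.
pose h y := w y - q (enorm (y - z)).
have cq : continuous (fun y : 'rV[R]_n.+1 => q (enorm (y - z))).
  move=> y.
  apply: (@continuous_comp _ _ _ (fun y : 'rV[R]_n.+1 => enorm (y - z)) q).
    exact: continuous_enorm_dist.
  apply: cvgB; last by apply: cvgM; [exact: cvg_cst|exact: exprn_continuous].
  by apply: cvgD; [exact: cvg_cst|apply: cvgM; [exact: cvg_cst|exact: cvg_id]].
have ch : {within closure Omega, continuous h}.
  by move=> y; apply: cvgB; [exact: cw|exact: (continuous_subspaceT cq)].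
(* The maximum of [h] is larger than the gap, so it is not on the boundary. *)
have [|x /set_mem cx xm] := EVT_max_rV _ compact_closure ch.
  by exists x1; exact: subset_closure.
have {}xm y : closure Omega y -> h y <= h x by move=> cy; exact/xm/mem_set.
have hx : K / 2 * eps ^+ 2 < h x.
  by apply: lt_le_trans (xm _ (subset_closure Ox1)); rewrite /h; lra.
have J0 : 0 <= K / 2 * eps ^+ 2 by rewrite mulr_ge0 ?sqr_ge0 // divr_ge0.
have Ox : Omega x.
  have [//|/wq] := closure_inside_or_boundary Omega_open cx.
  by rewrite /h in hx; lra.
pose t := enorm (x - z); pose s := b - K * t.
have s0 : 0 <= s by rewrite subr_ge0 bK.
have t0 : 0 < t.
  apply: enorm_gt0; rewrite subr_eq0; apply/eqP => xz.
  by apply: nOz; rewrite -xz.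
have q_tangent t' : q t' - q t <= s * (t' - t).
  rewrite -subr_ge0 (_ : _ - _ = K / 2 * (t' - t) ^+ 2).
    by rewrite mulr_ge0 ?sqr_ge0 // divr_ge0.
  by rewrite /q /s; field.
have Sp : Splus Omega eps w x <= s.
  apply: Splus_le => // y yb; have [cy _ _] := path_ball_enorm yb.
  have := xm _ cy; have := q_tangent (enorm (y - z)).
  have := rho_ge_enorm yb => /(ler_wpM2l s0).
  have : s * (enorm (y - z) - t) <= s * enorm (y - x).
    by rewrite ler_wpM2l // lerBlDr; exact: enorm_triangle.
  by rewrite /h -/t; lra.
pose e := t^-1 *: (z - x).
have e1 : enorm e = 1.
  by rewrite enormZ gtr0_norm ?invr_gt0 // enormB mulVf ?gt_eqF.
have xte : x + t *: e = z.
  by rewrite scalerA mulfV ?gt_eqF// scale1r addrC subrK.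
have xez r : 0 <= r <= t -> enorm (x + r *: e - z) = t - r.
  move=> /andP[r0 rt]; rewrite -xte opprD addrACA subrr add0r -scalerBl enormZ.
  by rewrite e1 mulr1 distrC ger0_norm // subr_ge0.
have xe_dist r : 0 <= r ->
    (forall r', 0 <= r' <= r -> closure Omega (x + r' *: e)) ->
    path_dist Omega x (x + r *: e) = r%:E.
  move=> r0 xr; rewrite path_dist_segment [_ + _ - x]addrAC subrr add0r.
    by rewrite enormZ e1 mulr1 ger0_norm.
  move=> u /andP[u0 u1]; rewrite scalerA; apply: xr.
  by rewrite mulr_ge0 //= ler_piMl.
have Sm : s + K / 2 * eps <= Sminus Omega eps w x.
  have [[r [/andP[r0 re] nOr]]|allO] :=
      pselect (exists r, 0 <= r <= eps /\ ~ Omega (x + r *: e)).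
    have [r1 [r10 r1r br1 Or1]] := ray_exit Omega_open Ox r0 nOr.
    have r1t : r1 <= t.
      rewrite leNgt; apply/negP => tr1; apply: nOz.
      by rewrite -xte; apply: Or1; rewrite (ltW t0).
    have r1e := le_trans r1r re.
    have d1 : path_dist Omega x (x + r1 *: e) = r1%:E.
      apply: xe_dist (ltW r10) _ => r' /andP[r'0].
      rewrite le_eqVlt => /predU1P[->|r'r1]; first by case: br1.
      by apply: subset_closure; apply: Or1; rewrite r'0.
    have b1 : path_ball Omega x eps (x + r1 *: e).
      by split; [case: br1|rewrite d1 lee_fin].
    apply: le_trans (Sminus_ge e0 cw Ox b1); rewrite rho_boundary // d1 /=.
    rewrite ler_pdivlMr //; have := wq _ br1; rewrite xez ?(ltW r10)//.
    have := q_tangent (t - r1).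
    have : K / 2 * (eps * r1) <= K / 2 * (eps * eps).
      by apply: ler_wpM2l; [rewrite divr_ge0|rewrite ler_wpM2l // ltW].
    by rewrite /h -/t in hx; lra.
  have {}allO r : 0 <= r <= eps -> Omega (x + r *: e).
    by move=> re; apply: contrapT => nO; apply: allO; exists r.
  have et : eps <= t.
    rewrite leNgt; apply/negP => te; apply: nOz; rewrite -xte.
    by apply: allO; rewrite (ltW t0) ltW.
  have Oe : Omega (x + eps *: e) by apply: allO; rewrite (ltW e0) lexx.
  have d1 : path_dist Omega x (x + eps *: e) = eps%:E.
    by apply: xe_dist (ltW e0) _ => r' re; apply: subset_closure; exact: allO.
  have b1 : path_ball Omega x eps (x + eps *: e).
    by split; [exact: subset_closure|rewrite d1 lee_fin].
  apply: le_trans (Sminus_ge e0 cw Ox b1); rewrite rho_inside //.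
  rewrite ler_pdivlMr //.
  have := xm _ (subset_closure Oe); rewrite /h xez ?(ltW e0)// -/t.
  have -> : q (t - eps) = q t - (s + K / 2 * eps) * eps.
    by rewrite /q /s; field.
  by lra.
have := wM _ Ox; rewrite /fd_inf_laplacian -mulrN opprB mulrC ler_pdivrMr //.
have : 2 * M * eps < K * eps by rewrite ltr_pM2r.
by lra.
Qed.

End FiniteDifferenceOperator.

(** * Equicontinuity *)

Section Equicontinuity.
Context {R : realType} {n : nat}.
Variable Omega : set 'rV[R]_n.+1.
Hypothesis Omega_open : open Omega.
Hypothesis Omega_bounded : bounded_set Omega.
Implicit Types (w f g : 'rV[R]_n.+1 -> R) (x y z : 'rV[R]_n.+1).

Lemma compact_boundary : compact (boundary Omega).
Proof.
apply: subclosed_compact (compact_closure Omega_bounded) _; last by move=> x [].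
rewrite /boundary setDE; apply: closedI; first exact: closed_closure.
by apply: open_closedC; exact: open_interior.
Qed.

Section SingleSolution.
Variables (eps M C : R) (w : 'rV[R]_n.+1 -> R).
Hypothesis eps_gt0 : 0 < eps.
Hypothesis M_ge0 : 0 <= M.
Hypothesis w_cont : {within closure Omega, continuous w}.
Hypothesis w_sub : forall x, Omega x -> - fd_inf_laplacian Omega eps w x <= M.
Hypothesis w_bound : forall x, closure Omega x -> `|w x| <= C.

(** From [x] the step leads to [y], and then to a maximum point [y1] of [w] over
    the ball around [y].  As [x] is in that ball, the equation at [y] bounds
    [w y1 - w y] from below by [w y - w x - eps ^+ 2 * M]. *)
Lemma ascent x0 y0 r : (forall y, enorm (y - x0) <= r -> Omega y) ->
  enorm (y0 - x0) <= eps ->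
  forall k : nat, k.+1%:R * eps <= r ->
  exists x y, [/\ enorm (x - x0) <= k%:R * eps, enorm (y - x) <= eps,
    w y0 - w x0 - k%:R * (eps ^+ 2 * M) <= w y - w x &
    k%:R * (w y0 - w x0) - k%:R ^+ 2 * (eps ^+ 2 * M) <= w x - w x0].
Proof.
move=> x0r y0e; elim=> [|k IH] kr.
  exists x0, y0; rewrite subrr enorm0 expr0n /= !mul0r !subr0.
  by split; rewrite ?mul0r // subrr.
have [|x [y [xx0 yx Pxy wx]]] := IH.
  by apply: le_trans kr; rewrite ler_wpM2r ?(ltW eps_gt0)// ler_nat.
have yx0 : enorm (y - x0) <= k.+1%:R * eps.
  by have := enorm_triangle y x x0; rewrite -[k.+1]addn1 natrD; lra.
have yO z : enorm (z - y) <= eps -> Omega z.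
  move=> zy; apply: x0r; apply: le_trans kr.
  by have := enorm_triangle z y x0; rewrite -[k.+2]addn1 natrD; lra.
have Oy : Omega y by apply: yO; rewrite subrr enorm0 ltW.
have [y1 [y2 [y1y y2y y12 E]]] :=
  fd_midrange Omega_open Omega_bounded eps_gt0 w_cont yO erefl.
have xy : enorm (x - y) <= eps by rewrite enormB.
have {y12 xy} /andP[y2x _] := y12 x xy.
have EM : eps ^+ 2 * - fd_inf_laplacian Omega eps w y <= eps ^+ 2 * M.
  by rewrite ler_wpM2l ?sqr_ge0 // w_sub.
exists y, y1; split=> //; first by rewrite -[k.+1]addn1 natrD; lra.
set m := eps ^+ 2 * M in EM Pxy wx *.
have m0 : 0 <= m by rewrite mulr_ge0 ?sqr_ge0.
have : 0 <= k%:R * m by rewrite mulr_ge0.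
by rewrite -[k.+1]addn1 natrD; lra.
Qed.

(** A chain of [k] steps of [ascent], with [k * eps] between [r / 4] and
    [r / 2], stays in the ball and climbs at most [2 * C]. *)
Lemma one_step_bound x0 y0 r : 0 < r ->
  (forall y, enorm (y - x0) <= r -> Omega y) ->
  eps <= r / 4 -> enorm (y0 - x0) <= eps ->
  w y0 - w x0 <= 4 * (2 * C + M * r ^+ 2) / r * eps.
Proof.
move=> r0 x0r er y0e.
have re0 : 0 <= r / (2 * eps) by rewrite divr_ge0 ?mulr_ge0 ?ltW.
have /andP[] := truncn_itv re0; set k := Num.truncn _.
rewrite ler_pdivlMr ?mulr_gt0// ltr_pdivrMr ?mulr_gt0// => kle klt.
rewrite -[k.+1]addn1 natrD in klt.
have [|x [y [xx0 _ _ wx]]] := ascent x0r y0e (k := k).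
  by rewrite -[k.+1]addn1 natrD; lra.
have cx : closure Omega x by apply: subset_closure; apply: x0r; lra.
have cx0 : closure Omega x0.
  by apply: subset_closure; apply: x0r; rewrite subrr enorm0 ltW.
have := w_bound cx; have := w_bound cx0; rewrite !ler_norml.
move=> /andP[w1 w2] /andP[w3 w4].
have C0 : 0 <= C by lra.
set P := w y0 - w x0 in wx *; pose t := k%:R * eps.
have tP : t * P <= (2 * C + M * t ^+ 2) * eps.
  rewrite (_ : t * P = (k%:R * P - k%:R ^+ 2 * (eps ^+ 2 * M) +
      k%:R ^+ 2 * (eps ^+ 2 * M)) * eps).
    apply: ler_wpM2r; first exact: ltW.
    by rewrite /t; lra.
  by rewrite /t; ring.
have t_lb : r / 4 <= t by rewrite /t; lra.
have t_ub : t <= r by rewrite /t; lra.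
have t2 : t ^+ 2 <= r ^+ 2 by rewrite ler_pXn2r ?nnegrE //; lra.
have tP' : t * P <= (2 * C + M * r ^+ 2) * eps.
  apply: le_trans tP _; rewrite ler_wpM2r ?(ltW eps_gt0)// lerD2l.
  by rewrite ler_wpM2l.
have B0 : 0 <= (2 * C + M * r ^+ 2) * eps.
  by rewrite mulr_ge0 ?(ltW eps_gt0)// addr_ge0 // mulr_ge0 // sqr_ge0.
rewrite mulrAC ler_pdivlMr //; have [P0|P0] := leP P 0.
  have Pr : P * r <= 0 by rewrite mulr_le0_ge0 // (ltW r0).
  by lra.
have : r / 4 * P <= t * P by rewrite ler_pM2r.
by lra.
Qed.

(** Adds up [one_step_bound] along the segment from [x0] to [x], cut into pieces
    no longer than [eps]. *)
Lemma interior_modulus x0 r : 0 < r ->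
  (forall y, enorm (y - x0) <= 2 * r -> Omega y) -> eps <= r / 4 ->
  forall x, enorm (x - x0) <= r ->
  `|w x - w x0| <= 4 * (2 * C + M * r ^+ 2) / r * (enorm (x - x0) + eps).
Proof.
move=> r0 x0r er; set L := 4 * _ / r.
have Or y z : enorm (y - x0) <= r -> enorm (z - y) <= r -> Omega z.
  by move=> yr zr; apply: x0r; have := enorm_triangle z y x0; lra.
have step x y : enorm (x - x0) <= r -> enorm (y - x0) <= r ->
    enorm (y - x) <= eps -> `|w y - w x| <= L * eps.
  move=> xr yr yx; rewrite ler_norml; apply/andP; split.
    rewrite -opprB lerN2; apply: one_step_bound => //; last by rewrite enormB.
    by move=> z; exact: Or.
  by apply: one_step_bound => // z; exact: Or.
have chain (k : nat) x : enorm (x - x0) <= k%:R * eps -> enorm (x - x0) <= r ->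
    `|w x - w x0| <= k%:R * (L * eps).
  elim: k x => [|k IH] x xk xr.
    rewrite mul0r in xk; have /enorm_eq0/subr0_eq-> : enorm (x - x0) = 0.
      by apply/eqP; rewrite eq_le xk enorm_ge0.
    by rewrite subrr normr0 mul0r.
  have k0 : 0 < k.+1%:R :> R by rewrite ltr0Sn.
  pose x' := x0 + (k%:R / k.+1%:R) *: (x - x0).
  have x'x0 : enorm (x' - x0) = k%:R / k.+1%:R * enorm (x - x0).
    by rewrite addrAC subrr add0r enormZ ger0_norm // divr_ge0.
  have xx' : enorm (x - x') = k.+1%:R^-1 * enorm (x - x0).
    have -> : x - x' = k.+1%:R^-1 *: (x - x0).
      rewrite /x' opprD addrA -[X in X - _]scale1r -scalerBl; congr (_ *: _).
      by rewrite -[k.+1]addn1 natrD; field; rewrite natr1 gt_eqF.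
    by rewrite enormZ ger0_norm // invr_ge0.
  have x'k : enorm (x' - x0) <= k%:R * eps.
    by rewrite x'x0 mulrAC -mulrA ler_wpM2l // ler_pdivrMr // mulrC.
  have x'r : enorm (x' - x0) <= r.
    apply: le_trans xr; rewrite x'x0 ler_piMl ?enorm_ge0 //.
    by rewrite ler_pdivrMr // mul1r ler_nat.
  have xx'e : enorm (x - x') <= eps by rewrite xx' ler_pdivrMl.
  have := IH _ x'k x'r; have := step _ _ x'r xr xx'e.
  have := ler_distD (w x') (w x) (w x0).
  by rewrite -[k.+1]addn1 natrD; lra.
move=> x xr.
have xe0 : 0 <= enorm (x - x0) / eps by rewrite divr_ge0 ?enorm_ge0 ?ltW.
have /andP[] := truncn_itv xe0; set k := Num.truncn _.
rewrite ler_pdivlMr // ltr_pdivrMr // => kle klt.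
apply: le_trans (chain k.+1 x (ltW klt) xr) _.
have C0 : 0 <= C.
  have cx0 : closure Omega x0.
    by apply/subset_closure/x0r; rewrite subrr enorm0 mulr_ge0 // ltW.
  exact: le_trans (normr_ge0 _) (w_bound cx0).
have L0 : 0 <= L.
  have S0 : 0 <= 2 * C + M * r ^+ 2.
    by apply: addr_ge0; apply: mulr_ge0 => //; exact: sqr_ge0.
  by apply: divr_ge0; [exact: mulr_ge0|exact: ltW].
rewrite mulrCA; apply: ler_wpM2l => //.
by rewrite -[k.+1]addn1 natrD; lra.
Qed.

End SingleSolution.

Section Family.
Variables (f g : 'rV[R]_n.+1 -> R).
Hypothesis f_bounded : [bounded f x | x in Omega].
Hypothesis g_cont : {within boundary Omega, continuous g}.
Variable W : R -> 'rV[R]_n.+1 -> R.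
Hypothesis W_sol : forall eps, 0 < eps -> fd_solution Omega eps f g (W eps).

Lemma boundary_data_bounded : exists2 G, 0 <= G &
  forall x, boundary Omega x -> `|g x| <= G.
Proof.
have /compact_bounded/bounded_onP[G gG] :
  compact (g @` boundary Omega) by exact: continuous_compact compact_boundary.
exists `|G| => // x bx; apply: le_trans (ler_norm G).
by apply: gG; exists x.
Qed.

Lemma source_bounded : exists2 M, 0 <= M & forall x, Omega x -> `|f x| <= M.
Proof.
have [M fM] := (bounded_onP _ _).1 f_bounded.
by exists `|M| => // x /fM /le_trans; apply; exact: ler_norm.
Qed.

(** The curvature [K] depends on the bound of [f] alone. *)
Lemma fd_solution_barrier : exists2 K, 0 <= K & forall eps, 0 < eps ->
  forall z a b, ~ Omega z -> (forall x, Omega x -> K * enorm (x - z) <= b) ->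
  let q t := a + b * t - K / 2 * t ^+ 2 in
  (forall x, boundary Omega x -> g x <= q (enorm (x - z))) ->
  forall x, Omega x -> W eps x <= q (enorm (x - z)) + K / 2 * eps ^+ 2.
Proof.
have [M M0 fM] := source_bounded.
exists (2 * M + 1) => [|eps e0 z a b nOz bK q gq]; first lra.
have [cw fw gw] := W_sol e0.
apply: (@quadratic_barrier _ _ _ Omega_open Omega_bounded _ _ M) => //.
- by move=> x Ox; rewrite fw //; apply: le_trans (fM _ Ox); exact: ler_norm.
- by rewrite addr_ge0 ?mulr_ge0.
- by lra.
- by move=> x bx; rewrite gw //; exact: gq.
Qed.

(** The barrier is centred at a point [z] beyond the domain, with a slope that
    keeps it increasing up to the distance [D], so that it dominates the
    boundary values everywhere. *)
Lemma uniform_upper_bound : exists C, forall eps, 0 < eps <= 1 ->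
  forall x, closure Omega x -> W eps x <= C.
Proof.
have [K K0 barrier] := fd_solution_barrier.
have [G G0 gG] := boundary_data_bounded.
have [B OB] := bounded_closure Omega_bounded.
pose z : 'rV[R]_n.+1 := const_mx (`|B| + 1).
have nOz : ~ Omega z.
  move=> /subset_closure/OB; apply/negP; rewrite -ltNge.
  apply: lt_le_trans (coord_le_enorm z 0); rewrite mxE ger0_norm ?addr_ge0//.
  by have := ler_norm B; lra.
pose D := `|B| + enorm z.
have zD x : closure Omega x -> enorm (x - z) <= D.
  move=> /OB xB; apply: le_trans (enormD _ _) _; rewrite enormN lerD2r.
  exact: le_trans xB (ler_norm B).
have D0 : 0 <= D by rewrite addr_ge0 ?enorm_ge0.
exists (G + K * D * D + K / 2) => eps /andP[e0 e1] x cx.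
have K2 t : 0 <= t <= D -> 0 <= K * t * (D - t / 2) <= K * D * D.
  move=> /andP[t0 tD]; apply/andP; split; first by rewrite !mulr_ge0 //; lra.
  by rewrite -!mulrA ler_wpM2l // ler_pM //; lra.
have K3 := K2 _ (introT andP (conj (enorm_ge0 _) (zD _ _))).
have [Ox|bx] := closure_inside_or_boundary Omega_open cx.
  have Ob y : Omega y -> K * enorm (y - z) <= K * D.
    by move=> /subset_closure/zD yD; rewrite ler_wpM2l.
  have Gb y : boundary Omega y ->
      g y <= G + K * D * enorm (y - z) - K / 2 * enorm (y - z) ^+ 2.
    move=> by_; have := gG _ by_; have /andP[H _] := K3 y by_.1.
    by rewrite ler_norml; lra.
  have := barrier _ e0 z G (K * D) nOz Ob Gb x Ox.
  have /andP[_ H] := K3 x cx.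
  have : K / 2 * eps ^+ 2 <= K / 2 * 1.
    by rewrite ler_wpM2l ?divr_ge0 // expr_le1 // ltW.
  by lra.
have [_ _ gw] := W_sol e0; rewrite gw //; have := gG _ bx.
have : 0 <= K * D * D by rewrite !mulr_ge0.
by rewrite ler_norml; lra.
Qed.

(** The slope [b] of the barrier is chosen so large that the barrier exceeds
    [G] outside the ball of radius [d0], inside which continuity of [g] is
    enough. *)
Lemma boundary_upper_modulus z eta : boundary Omega z -> 0 < eta ->
  exists2 d, 0 < d & forall eps, 0 < eps < d -> forall x, closure Omega x ->
    enorm (x - z) < d -> W eps x <= g z + eta.
Proof.
move=> bz eta0.
have [K K0 barrier] := fd_solution_barrier.
have [G G0 gG] := boundary_data_bounded.
have [B OB] := bounded_closure Omega_bounded.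
have /within_continuous_enorm/(_ z bz (eta / 2))[|d0 d00 gd] := g_cont.
  by rewrite divr_gt0.
pose D := 2 * B.
have zD x : closure Omega x -> enorm (x - z) <= D.
  move=> /OB xB; apply: le_trans (enormD _ _) _; rewrite enormN.
  by have := OB _ bz.1; rewrite /D; lra.
have D0 : 0 <= D by apply: le_trans (enorm_ge0 _) (zD _ bz.1).
pose b := K * D + 4 * G / d0.
have Gd0 : 0 <= 4 * G / d0 by rewrite divr_ge0 ?mulr_ge0 // ltW.
have b0 : 0 <= b by rewrite addr_ge0 // mulr_ge0.
have c0 : 0 < 4 * (b + K + 1) by rewrite mulr_gt0 // ltr_wpDl // addr_ge0.
exists (Num.min d0 (Num.min 1 (eta / (4 * (b + K + 1))))).
  by rewrite !lt_min d00 ltr01 divr_gt0.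
move=> eps; rewrite !lt_min => /andP[e0 /and3P[_ e1 e2]] x cx.
rewrite !lt_min => /and3P[xd0 x1 x2].
have [Ox|bx] := closure_inside_or_boundary Omega_open cx; last first.
  have [_ _ gw] := W_sol e0; rewrite gw //; have := gd _ bx xd0.
  by rewrite ltr_norml; lra.
have Ob y : Omega y -> K * enorm (y - z) <= b.
  by move=> /subset_closure/zD/(ler_wpM2l K0); rewrite /b; lra.
have Gb y : boundary Omega y ->
    g y <= g z + eta / 2 + b * enorm (y - z) - K / 2 * enorm (y - z) ^+ 2.
  move=> by_; set t := enorm _; have tD : t <= D := zD _ by_.1.
  have t0 : 0 <= t := enorm_ge0 _.
  have Kt : 0 <= K * t * (D - t / 2) by rewrite !mulr_ge0 //; lra.
  have [td0|td0] := ltP t d0.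
    have := gd _ by_ td0; have : 0 <= 4 * G / d0 * t by rewrite mulr_ge0.
    by rewrite ltr_norml /b; lra.
  have : 4 * G <= 4 * G / d0 * t.
    by rewrite mulrAC ler_pdivlMr // ler_wpM2l // mulr_ge0.
  have := gG _ by_; have := gG _ bz; rewrite !ler_norml /b.
  by lra.
have := barrier _ e0 z _ b (boundary_notin Omega_open bz) Ob Gb x Ox.
have Kx : 0 <= K / 2 * enorm (x - z) ^+ 2.
  by rewrite mulr_ge0 ?sqr_ge0 // divr_ge0.
have Ke : K / 2 * eps ^+ 2 <= K / 2 * eps.
  by rewrite ler_wpM2l ?divr_ge0 // expr2 ler_piMl // ltW.
rewrite ltr_pdivlMr // in e2; rewrite ltr_pdivlMr // in x2.
have bx0 : 0 <= K * enorm (x - z) by rewrite mulr_ge0 ?enorm_ge0.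
have be0 : 0 <= b * eps by rewrite mulr_ge0 // ltW.
have := enorm_ge0 (x - z).
by lra.
Qed.

End Family.

End Equicontinuity.

Section TwoSidedEstimates.
Context {R : realType} {n : nat}.
Variable Omega : set 'rV[R]_n.+1.
Hypothesis Omega_open : open Omega.
Hypothesis Omega_bounded : bounded_set Omega.
Variables (f g : 'rV[R]_n.+1 -> R).
Hypothesis f_bounded : [bounded f x | x in Omega].
Hypothesis g_cont : {within boundary Omega, continuous g}.
Variable W : R -> 'rV[R]_n.+1 -> R.
Hypothesis W_sol : forall eps, 0 < eps -> fd_solution Omega eps f g (W eps).

Let Nf_bounded : [bounded (\- f) x | x in Omega].
Proof.
have [M fM] := (bounded_onP _ _).1 f_bounded.
by apply/bounded_onP; exists M => x /fM; rewrite /= normrN.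
Qed.

Let Ng_cont : {within boundary Omega, continuous (\- g)}.
Proof. by move=> x; apply: continuousN; exact: g_cont. Qed.

Let NW_sol eps : 0 < eps ->
  fd_solution Omega eps (\- f) (\- g) (\- W eps).
Proof. by move=> e0; apply: fd_solutionN; exact: W_sol. Qed.

Lemma uniform_bound : exists C, forall eps, 0 < eps <= 1 ->
  forall x, closure Omega x -> `|W eps x| <= C.
Proof.
have [C1 W1] := uniform_upper_bound Omega_open Omega_bounded
  f_bounded g_cont W_sol.
have [C2 W2] := uniform_upper_bound Omega_open Omega_bounded
  Nf_bounded Ng_cont NW_sol.
exists (Num.max C1 C2) => eps e01 x cx; rewrite ler_norml lerNl !le_max.
by rewrite W1 // W2 // orbT.
Qed.

(** Near a boundary point the two one-sided moduli combine because all the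
    solutions share the value [g z] there. *)
Lemma equicontinuity z eta : closure Omega z -> 0 < eta ->
  exists2 d, 0 < d & forall eps, 0 < eps < d -> forall x, closure Omega x ->
    enorm (x - z) < d -> `|W eps x - W eps z| < eta.
Proof.
move=> cz eta0; have eta2 : 0 < eta / 2 by rewrite divr_gt0.
have [Oz|bz] := closure_inside_or_boundary Omega_open cz; last first.
  have [d1 d10 W1] := boundary_upper_modulus Omega_open Omega_bounded
    f_bounded g_cont W_sol bz eta2.
  have [d2 d20 W2] := boundary_upper_modulus Omega_open Omega_bounded
    Nf_bounded Ng_cont NW_sol bz eta2.
  exists (Num.min d1 d2) => [|eps]; first by rewrite lt_min d10.
  rewrite lt_min => /and3P[e0 e1 e2] x cx; rewrite lt_min => /andP[x1 x2].
  have := W1 eps (introT andP (conj e0 e1)) x cx x1.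
  have := W2 eps (introT andP (conj e0 e2)) x cx x2.
  have [_ _ gw] := W_sol e0; rewrite (gw z) //= ltr_norml.
  by lra.
have [M M0 fM] := source_bounded f_bounded.
have [C0 WC0] := uniform_bound.
pose C := `|C0|; have Cge0 : 0 <= C := normr_ge0 C0.
have [d0 d00 dO] := open_enorm Omega_open Oz.
pose r := d0 / 2; have r0 : 0 < r by rewrite divr_gt0.
pose L := 4 * (2 * C + M * r ^+ 2) / r.
have L0 : 0 <= L.
  have S0 : 0 <= 2 * C + M * r ^+ 2.
    by apply: addr_ge0; apply: mulr_ge0 => //; exact: sqr_ge0.
  by apply: divr_ge0; [exact: mulr_ge0|exact: ltW].
have c0 : 0 < 2 * L + 1 by rewrite ltr_wpDl // mulr_ge0.
exists (Num.min 1 (Num.min (r / 4) (eta / (2 * L + 1)))).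
  by rewrite !lt_min ltr01 !divr_gt0.
move=> eps; rewrite !lt_min => /and4P[e0 e1 er eL] x cx.
rewrite !lt_min => /and3P[x1 xr xL].
have [cw fw _] := W_sol e0.
have sub y : Omega y -> - fd_inf_laplacian Omega eps (W eps) y <= M.
  by move=> Oy; rewrite fw //; exact: le_trans (ler_norm _) (fM _ Oy).
have WC y : closure Omega y -> `|W eps y| <= C.
  move=> cy; apply: le_trans (ler_norm _).
  by apply: WC0; rewrite ?e0 ?ltW.
have zr y : enorm (y - z) <= 2 * r -> Omega y.
  by move=> yz; apply: dO; rewrite /r in yz; lra.
have xr' : enorm (x - z) <= r by have := r0; lra.
have := interior_modulus Omega_open Omega_bounded e0 M0 cw sub WC r0 zr
  (ltW er) xr'.
rewrite -/L => /le_lt_trans; apply.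
rewrite ltr_pdivlMr // in eL; rewrite ltr_pdivlMr // in xL.
by have := enorm_ge0 (x - z); lra.
Qed.

End TwoSidedEstimates.

(** * Quadratic test functions *)

Section QuadraticPolynomial.
Context {R : realType} {n : nat}.
Implicit Types (u v x h : 'rV[R]_n.+1) (A : 'M[R]_n.+1).

Definition quad_form A h : R := dotv (h *m A) h.

Definition quad_poly (c : R) b A x : R := c + dotv b x + quad_form A x.

Lemma dotv_mulmx A u v : dotv (u *m A) v = dotv u (v *m A^T).
Proof.
have E u' v' : dotv u' v' = (u' *m v'^T) 0 0.
  by rewrite mxE; apply: eq_bigr => i _; rewrite mxE.
by rewrite !E trmx_mul trmxK mulmxA.
Qed.

Lemma quad_formZ A a h : quad_form A (a *: h) = a ^+ 2 * quad_form A h.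
Proof. by rewrite /quad_form -scalemxAl dotvZl dotvZr mulrA. Qed.

Lemma quad_formD A x h :
  quad_form A (x + h) = quad_form A x + dotv (x *m (A + A^T)) h + quad_form A h.
Proof.
rewrite /quad_form mulmxDl !dotvDl !dotvDr mulmxDr dotvDl (dotv_mulmx A h x).
by rewrite (dotvC h); ring.
Qed.

Lemma quad_form_sym A h : dotv (h *m (A + A^T)) h = 2 * quad_form A h.
Proof.
by rewrite mulmxDr dotvDl [X in _ + X]dotvC -dotv_mulmx /quad_form; ring.
Qed.

Lemma quad_polyD c b A x h : quad_poly c b A (x + h) =
  quad_poly c b A x + dotv (b + x *m (A + A^T)) h + quad_form A h.
Proof. by rewrite /quad_poly quad_formD dotvDr dotvDl; ring. Qed.

Lemma quad_form_bound A : exists2 C, 0 <= C &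
  forall h, `|quad_form A h| <= C * enorm h ^+ 2.
Proof.
exists (\sum_j \sum_i `|A i j|) => [|h].
  by apply: sumr_ge0 => j _; apply: sumr_ge0.
rewrite /quad_form /dotv mulr_suml; apply: le_trans (ler_norm_sum _ _ _) _.
apply: ler_sum => j _; rewrite mxE !mulr_suml.
apply: le_trans (ler_norm_sum _ _ _) _; apply: ler_sum => i _.
rewrite !normrM mulrAC mulrC ler_wpM2l // expr2.
by rewrite ler_pM // coord_le_enorm.
Qed.

Lemma continuous_quad_poly c b A : continuous (quad_poly c b A).
Proof.
move=> x; apply/continuous_at_enorm => e e0.
have [C C0 CA] := quad_form_bound A.
set p := b + x *m (A + A^T); have p0 := enorm_ge0 p.
have D0 : 0 < enorm p + C + 1 by rewrite ltr_wpDl // addr_ge0.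
exists (Num.min 1 (e / (enorm p + C + 1))).
  by rewrite lt_min ltr01 divr_gt0.
move=> y; rewrite lt_min => /andP[yx1]; rewrite ltr_pdivlMr // => yxe.
set h := y - x in yx1 yxe.
have -> : quad_poly c b A y - quad_poly c b A x = dotv p h + quad_form A h.
  have -> : y = x + h by rewrite addrC subrK.
  by rewrite quad_polyD; ring.
have h0 := enorm_ge0 h.
have h2 : C * enorm h ^+ 2 <= C * enorm h.
  by rewrite ler_wpM2l // expr2 ler_piMl // ltW.
have := CA h; have := dotv_le_enorm p h; have := dotv_le_enorm (- p) h.
by rewrite dotvNl enormN ltr_norml ler_norml; lra.
Qed.

Lemma continuous_quad_form A : continuous (quad_form A).
Proof.
have -> : quad_form A = quad_poly 0 0 A.
  by apply/funext => h; rewrite /quad_poly dotv0l !add0r.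
exact: continuous_quad_poly.
Qed.

(** Covers both derivatives of a quadratic polynomial: the polynomial itself,
    and its partial derivatives, for which [k = 0]. *)
Lemma derive_quadratic (phi : 'rV[R]_n.+1 -> R) v x l k :
  (forall t, phi (t *: v + x) = phi x + t * l + t ^+ 2 * k) ->
  'D_v phi x = l.
Proof.
move=> E; apply: cvg_lim => //.
have H : (fun t : R => l + t * k) t @[t --> 0^'] --> l.
  rewrite -[X in _ --> X]addr0 -[X in _ + X](mul0r k).
  apply: cvgD; first exact: cvg_cst.
  by apply: cvgM; [apply: cvg_within; exact: cvg_id|exact: cvg_cst].
apply: cvg_trans H; apply: near_eq_cvg; near=> t.
have t0 : t != 0 by near: t; exact: nbhs_dnbhs_neq.
by rewrite /= E /GRing.scale /=; field.
Unshelve. all: by end_near. Qed.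

Lemma dotv_basis v i : dotv v (basis_vec i) = v 0 i.
Proof.
rewrite /dotv (bigD1 i) //= big1 ?addr0 => [|j ji].
  by rewrite mxE !eqxx mulr1.
by rewrite mxE eqxx /= (negbTE ji) mulr0.
Qed.

Lemma gradient_quad_poly c b A x :
  gradient (quad_poly c b A) x = b + x *m (A + A^T).
Proof.
apply/rowP => i; rewrite mxE -dotv_basis.
apply: (derive_quadratic (k := quad_form A (basis_vec i))) => t.
by rewrite addrC quad_polyD dotvZr quad_formZ.
Qed.

Lemma hessian_quad_poly c b A x : hessian (quad_poly c b A) x = A + A^T.
Proof.
apply/matrixP => i j; rewrite mxE.
have E y : 'D_(basis_vec j) (quad_poly c b A) y =
    dotv (b + y *m (A + A^T)) (basis_vec j).
  rewrite -(gradient_quad_poly c) dotv_basis [in RHS]mxE.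
  by [].
rewrite (_ : (fun y => _) = fun y => dotv (b + y *m (A + A^T)) (basis_vec j)).
  have -> : (A + A^T) i j = dotv (basis_vec i *m (A + A^T)) (basis_vec j).
    by rewrite dotv_basis /basis_vec -rowE [RHS]mxE.
  apply: (derive_quadratic (k := 0)) => t.
  by rewrite mulmxDl -scalemxAl !dotvDl dotvZl; ring.
by apply/funext => y; rewrite E.
Qed.

Lemma hess_form_quad_poly c b A x v :
  hess_form (quad_poly c b A) x v = 2 * quad_form A v.
Proof. by rewrite /hess_form hessian_quad_poly quad_form_sym. Qed.

Lemma poly_deg_le2E (phi : 'rV[R]_n.+1 -> R) : poly_deg_le2 phi ->
  exists c b A, phi = quad_poly c b A.
Proof.
move=> [c [b [A E]]]; exists c, b, A; apply/funext => x; rewrite E.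
rewrite /quad_poly; congr (_ + _); rewrite exchange_big /=.
apply: eq_bigr => j _; rewrite mxE mulr_suml.
by apply: eq_bigr => i _; rewrite [A i j * _]mulrC.
Qed.

Lemma quad_poly_deg_le2 c b A : poly_deg_le2 (quad_poly c b A).
Proof.
exists c, b, A => x; rewrite /quad_poly; congr (_ + _).
rewrite [RHS]exchange_big /=; apply: eq_bigr => j _; rewrite mxE mulr_suml.
by apply: eq_bigr => i _; rewrite [A i j * _]mulrC.
Qed.

Lemma strict_local_max_enorm (h : 'rV[R]_n.+1 -> R) x0 :
  strict_local_max h x0 <-> exists2 d, 0 < d &
    forall y, enorm (y - x0) < d -> y != x0 -> h y < h x0.
Proof.
rewrite /strict_local_max near_withinE; split.
  by move=> /nbhs_enorm[d d0 H]; exists d => // y yx yx0; exact: H.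
by move=> [d d0 H]; apply/nbhs_enorm; exists d => // y yx yx0; exact: H.
Qed.

End QuadraticPolynomial.

(** * Viscosity inequality for limits along an ultrafilter *)

(** This replaces the extraction of convergent subsequences. *)
Lemma ultra_compact_cvg (T : Type) (X : topologicalType) (U : set_system T)
    (K : set X) (h : T -> X) : UltraFilter U -> compact K ->
  U [set t | K (h t)] -> exists2 x, K x & h @ U --> x.
Proof.
move=> UU cK UK; have [x [Kx hx]] := cK _ (fmap_proper_filter h _) UK.
exists x => // B xB; have [//|nB] := in_ultra_setVsetC (h @^-1` B) UU.
by have [y [nBy /nBy]] := hx (~` B) B nB xB.
Qed.

Section UltralimitSubsolution.
Context {R : realType} {n : nat}.
Variable Omega : set 'rV[R]_n.+1.
Hypothesis Omega_open : open Omega.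
Hypothesis Omega_bounded : bounded_set Omega.
Variables (f g : 'rV[R]_n.+1 -> R).
Hypothesis f_cont : {within Omega, continuous f}.
Variable W : R -> 'rV[R]_n.+1 -> R.
Hypothesis W_sol : forall eps, 0 < eps -> fd_solution Omega eps f g (W eps).
Variable U : set_system R.
Hypothesis U_ultra : UltraFilter U.
Hypothesis U_right : forall d, 0 < d -> U [set eps | 0 < eps < d].
Variable v : 'rV[R]_n.+1 -> R.
Hypothesis W_cvg : forall z eta, closure Omega z -> 0 < eta ->
  exists2 d, 0 < d & U [set eps | forall x, closure Omega x ->
    enorm (x - z) < d -> `|W eps x - v z| < eta].

Lemma ultralimit_continuous : {within closure Omega, continuous v}.
Proof.
apply/within_continuous_enorm => x cx e e0.
have e2 : 0 < e / 2 by rewrite divr_gt0.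
have [d d0 Ux] := W_cvg cx e2; exists d => // y cy yx.
have [d' d'0 Uy] := W_cvg cy e2.
have [eps [Wx Wy]] := filter_ex (filterI Ux Uy).
have := Wx y cy yx; have := Wy y cy; rewrite subrr enorm0 => /(_ d'0).
by rewrite !ltr_norml; lra.
Qed.

Lemma ultralimit_comp (X : R -> 'rV[R]_n.+1) x (h : 'rV[R]_n.+1 -> R) :
  (forall d, 0 < d -> U [set eps | enorm (X eps - x) < d]) ->
  continuous h -> h (X eps) @[eps --> U] --> h x.
Proof.
move=> Xx ch; apply/cvgrPdist_lt => e e0.
have [d d0 xd] := (continuous_at_enorm h x).1 (ch x) e e0.
by apply: filterS (Xx d d0) => eps /xd; rewrite /= distrC.
Qed.

(** The maximum of the test function over a small ball is attained in a
    direction which the ultrafilter makes converge to some [e]; comparing the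
    minimum with the value at the opposite point cancels the first-order
    terms and leaves [2 * quad_form A e]. *)
Lemma ultralimit_touching c b A x0 : Omega x0 ->
  strict_local_max (v \- quad_poly c b A) x0 ->
  let p := b + x0 *m (A + A^T) in
  exists e, [/\ enorm e <= 1, enorm p <= dotv p e &
    - (2 * quad_form A e) <= f x0].
Proof.
move=> Ox0 /strict_local_max_enorm[r1 r10 v_max] p.
set phi := quad_poly c b A in v_max.
pose P x := b + x *m (A + A^T).
have phiD x h : phi (x + h) = phi x + dotv (P x) h + quad_form A h.
  exact: quad_polyD.
have phi_cont : continuous phi by exact: continuous_quad_poly.
have Q_cont : continuous (quad_form A) by exact: continuous_quad_form.
have [r2 r20 x0O] := open_enorm Omega_open Ox0.
pose r := Num.min (r1 / 2) r2.
have r0 : 0 < r by rewrite lt_min r20 divr_gt0.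
have rr1 : r < r1 by rewrite gt_min; apply/orP; left; lra.
have rO y : enorm (y - x0) <= r -> Omega y.
  by move=> yr; apply: x0O; apply: le_trans yr _; rewrite ge_min lexx orbT.
have v_max' y : enorm (y - x0) <= r -> y != x0 -> v y - phi y < v x0 - phi x0.
  by move=> yr; apply: v_max; exact: le_lt_trans rr1.
have x00 : enorm (x0 - x0) <= r by rewrite subrr enorm0 ltW.
pose extremal eps (xe : 'rV[R]_n.+1 * 'rV[R]_n.+1) := 0 < eps ->
  [/\ enorm (xe.1 - x0) <= r,
    forall y, enorm (y - x0) <= r ->
      W eps y - phi y <= W eps xe.1 - phi xe.1,
    enorm (xe.2 - 0) <= 1 &
    forall e, enorm e <= 1 ->
      dotv (P xe.1) e + eps * quad_form A e <=
      dotv (P xe.1) xe.2 + eps * quad_form A xe.2].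
have [XE XEP] : {XE & forall eps, extremal eps (XE eps)}.
  apply: choice => eps; rewrite /extremal.
  have [e0|e0] := ltP 0 eps; last by exists (0, 0).
  have [cw _ _] := W_sol e0.
  have cwphi : {within [set y | enorm (y - x0) <= r],
      continuous (fun y => W eps y - phi y)}.
    apply: (@continuous_subspaceW _ _ _ (closure Omega)) => [y /rO|].
      exact: subset_closure.
    move=> y; apply: cvgB; first exact: cw.
    exact: (continuous_subspaceT phi_cont).
  have [|x /set_mem xr xm] := EVT_max_rV _ (@compact_enorm_ball _ _ x0 r) cwphi.
    by exists x0.
  have clin : continuous (quad_poly 0 (P x) (eps *: A)).
    exact: continuous_quad_poly.
  have [|e /set_mem e1 em] := EVT_max_rV _ (@compact_enorm_ball _ _ 0 1)
    (continuous_subspaceT clin).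
    by exists 0; rewrite /= subrr enorm0.
  have linE e' : quad_poly 0 (P x) (eps *: A) e' =
      dotv (P x) e' + eps * quad_form A e'.
    by rewrite /quad_poly add0r /quad_form -scalemxAr dotvZl.
  exists (x, e) => _; split=> //= [y yr|e' e'1]; first exact/xm/mem_set.
  by rewrite -!linE; apply/em/mem_set; rewrite /= subr0.
rewrite /extremal in XEP.
pose X eps := (XE eps).1; pose E eps := (XE eps).2.
have Upos : U [set eps | 0 < eps].
  by apply: filterS (U_right ltr01) => eps /andP[].
have UX : U [set eps | [set y | enorm (y - x0) <= r] (X eps)].
  by apply: filterS Upos => eps /XEP[].
have UE : U [set eps | [set y | enorm (y - 0) <= 1] (E eps)].
  by apply: filterS Upos => eps /XEP[].
have [x xr Xx] := ultra_compact_cvg U_ultra (@compact_enorm_ball _ _ x0 r) UX.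
have [e e1 Ee] := ultra_compact_cvg U_ultra (@compact_enorm_ball _ _ 0 1) UE.
rewrite /= subr0 in e1.
have X_cvg d : 0 < d -> U [set eps | enorm (X eps - x) < d].
  move=> d0; apply: (Xx [set y | enorm (y - x) < d]).
  by apply/nbhs_enorm; exists d.
have E_cvg d : 0 < d -> U [set eps | enorm (E eps - e) < d].
  move=> d0; apply: (Ee [set y | enorm (y - e) < d]).
  by apply/nbhs_enorm; exists d.
(* By strictness of the maximum the contact points converge to [x0]. *)
have xx0 : x = x0.
  apply/eqP; apply: contraT => xx0; have gap := v_max' x xr xx0.
  pose eta := (v x0 - phi x0 - (v x - phi x)) / 4.
  have eta0 : 0 < eta by rewrite divr_gt0 // subr_gt0.
  have [d1 d10 U1] := W_cvg (subset_closure (rO x xr)) eta0.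
  have [d2 d20 U2] := W_cvg (subset_closure Ox0) eta0.
  have /cvgrPdist_lt/(_ eta eta0) U3 := ultralimit_comp X_cvg phi_cont.
  have [eps [[[[W1 W2] phi3] Xd] e0]] := filter_ex (filterI (filterI (filterI
    (filterI U1 U2) U3) (X_cvg _ d10)) Upos).
  have [Xr Xm _ _] := XEP eps e0.
  have := Xm x0 x00; have := W1 _ (subset_closure (rO _ Xr)) Xd.
  have := W2 x0 (subset_closure Ox0); rewrite subrr enorm0 => /(_ d20).
  by move: phi3; rewrite /= -/(X eps) !ltr_norml /eta; lra.
subst x.
have idU : eps @[eps --> U] --> (0 : R).
  apply/cvgrPdist_lt => d d0; apply: filterS (U_right d0) => eps /andP[e0 ed].
  by rewrite sub0r normrN gtr0_norm.
have UQ : eps * quad_form A (E eps) @[eps --> U] --> 0 * quad_form A e.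
  by apply: cvgM; [exact: idU|exact: (ultralimit_comp E_cvg Q_cont)].
(* The gradient [P] is only ever paired with vectors, so its continuity is read
   off from that of [phi]. *)
have dotE x h : dotv (P x) h = phi (x + h) - phi x - quad_form A h.
  by rewrite phiD; ring.
have dot_cvg (H : R -> 'rV[R]_n.+1) h :
    (forall d, 0 < d -> U [set eps | enorm (H eps - h) < d]) ->
    dotv (P (X eps)) (H eps) @[eps --> U] --> dotv p h.
  move=> Hh; have -> : (fun eps => dotv (P (X eps)) (H eps)) =
      (fun eps => phi (X eps + H eps) - phi (X eps) - quad_form A (H eps)).
    by apply/funext => eps; rewrite dotE.
  rewrite -[p]/(P x0) dotE; apply: cvgB; last exact: ultralimit_comp.
  apply: cvgB; last exact: ultralimit_comp.
  apply: (@ultralimit_comp (fun eps => X eps + H eps)) => // d d0.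
  have d2 : 0 < d / 2 by rewrite divr_gt0.
  apply: filterS (filterI (X_cvg _ d2) (Hh _ d2)) => eps /= [Xd Hd].
  by rewrite opprD addrACA; apply: le_lt_trans (enormD _ _) _; lra.
have e_max e' : enorm e' <= 1 -> dotv p e' <= dotv p e.
  move=> e'1.
  have cl : dotv (P (X eps)) e' + eps * quad_form A e' @[eps --> U] -->
      dotv p e' + 0 * quad_form A e'.
    apply: cvgD; last by apply: cvgM; [exact: idU|exact: cvg_cst].
    apply: (@dot_cvg (fun=> e')) => d d0; rewrite subrr enorm0.
    by apply: filterS Upos.
  have cr : dotv (P (X eps)) (E eps) + eps * quad_form A (E eps)
      @[eps --> U] --> dotv p e + 0 * quad_form A e.
    by apply: cvgD; [exact: dot_cvg|exact: UQ].
  have := ler_cvg_to cl cr; rewrite !mul0r !addr0; apply.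
  by apply: filterS Upos => eps /XEP[_ _ _]; exact.
exists e; split=> //.
  have [->|p0] := eqVneq p 0; first by rewrite enorm0 dotv0l.
  have np := enorm_gt0 p0.
  have /e_max : enorm ((enorm p)^-1 *: p) <= 1.
    by rewrite enormZ gtr0_norm ?invr_gt0 // mulVf ?gt_eqF.
  by rewrite dotvZr -sqr_enorm expr2 mulrA mulVf ?gt_eqF // mul1r.
have f_cvg : f (X eps) @[eps --> U] --> f x0.
  apply/cvgrPdist_lt => d d0.
  have /within_continuous_enorm/(_ x0 Ox0 d d0)[d' d'0 fd] := f_cont.
  apply: filterS (filterI (X_cvg _ d'0) UX) => eps /= [Xd Xr].
  by rewrite distrC; apply: fd => //; exact: rO.
have Q_cvg : - (2 * quad_form A (E eps)) @[eps --> U] --> - (2 * quad_form A e).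
  apply: cvgN; apply: cvgM; first exact: cvg_cst.
  exact: (ultralimit_comp E_cvg Q_cont).
apply: (ler_cvg_to Q_cvg f_cvg).
have r2' : 0 < r / 2 by rewrite divr_gt0.
apply: filterS (filterI (X_cvg _ r2') (U_right r2')) => eps [/= Xr2].
move=> /andP[e0 er].
have [Xr Xm E1 Em] := XEP eps e0; rewrite subr0 in E1.
rewrite -/(X eps) -/(E eps) in Xr Xm E1 Em.
have [cw fw _] := W_sol e0.
have ball_r y : enorm (y - X eps) <= eps -> enorm (y - x0) <= r.
  by move=> yX; have := enorm_triangle y (X eps) x0; lra.
have XO y : enorm (y - X eps) <= eps -> Omega y by move=> /ball_r/rO.
have [y1 [y2 [y1X y2X y12 EW]]] :=
  fd_midrange Omega_open Omega_bounded e0 cw XO (fw _ (rO _ Xr)).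
have W_phi y : enorm (y - X eps) <= eps ->
    W eps y - W eps (X eps) <=
    dotv (P (X eps)) (y - X eps) + quad_form A (y - X eps).
  move=> yX; have := Xm y (ball_r y yX).
  have := phiD (X eps) (y - X eps); rewrite [X eps + _]addrC subrK.
  by lra.
have {}y1W : W eps y1 - W eps (X eps) <=
    eps * dotv (P (X eps)) (E eps) + eps ^+ 2 * quad_form A (E eps).
  pose e' := eps^-1 *: (y1 - X eps).
  have ye : y1 - X eps = eps *: e' by rewrite scalerA mulfV ?gt_eqF// scale1r.
  have e'1 : enorm e' <= 1.
    by rewrite enormZ gtr0_norm ?invr_gt0 // ler_pdivrMl // mulr1.
  apply: le_trans (W_phi _ y1X) _; rewrite ye dotvZr quad_formZ.
  have := ler_wpM2l (ltW e0) (Em _ e'1); lra.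
pose y' := X eps - eps *: E eps.
have y'X : y' - X eps = (- eps) *: E eps.
  by rewrite addrAC subrr add0r scaleNr.
have y'e : enorm (y' - X eps) <= eps.
  by rewrite y'X enormZ normrN gtr0_norm // ler_piMr // ltW.
have Wy' := W_phi _ y'e; rewrite y'X dotvZr quad_formZ in Wy'.
have /andP[y2W _] := y12 _ y'e.
rewrite -(@ler_pM2l _ (eps ^+ 2)) ?exprn_gt0 // -EW.
by lra.
Qed.

(** At a critical point where the test function is strictly concave,
    [ultralimit_touching] gives too little, since the direction [e] may vanish.
    Moving the vertex of the paraboloid to a nearby [y] moves the contact point
    to some [x] which differs from [y], so that the gradient there is nonzero;
    the slightly smaller curvature [mu] makes the contact strict. *)
Lemma ultralimit_paraboloid x0 k r : Omega x0 -> 0 < k -> 0 < r ->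
  (forall x, enorm (x - x0) < r -> v x <= v x0 - k / 2 * enorm (x - x0) ^+ 2) ->
  k <= f x0.
Proof.
move=> Ox0 k0 r0 vk; rewrite leNgt; apply/negP => fk.
(* [mu] is below the curvature [k] but still contradicts the equation near [x0];
   the paraboloid of curvature [nu] in between leaves room for strictness. *)
pose mu := Num.max ((f x0 + k) / 2) (k / 2).
have fmu : f x0 < mu by rewrite lt_max; apply/orP; left; lra.
have mu0 : 0 < mu by rewrite lt_max; apply/orP; right; lra.
have muk : mu < k by rewrite gt_max; apply/andP; split; lra.
have [nu [munu nuk]] : exists nu, mu < nu /\ nu < k.
  by exists ((mu + k) / 2); split; lra.
have nu0 : 0 < nu := lt_trans mu0 munu.
have fmu0 : 0 < mu - f x0 by rewrite subr_gt0.
have [d d0 fd] := (within_continuous_enorm _ _).1 f_cont x0 Ox0 _ fmu0.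
have [r2 r20 x0O] := open_enorm Omega_open Ox0.
pose r' := Num.min (r / 2) (Num.min r2 (d / 2)).
have r'0 : 0 < r' by rewrite !lt_min r20 !divr_gt0.
have r'r : r' < r by rewrite gt_min; apply/orP; left; lra.
have r'r2 : r' <= r2 by rewrite !ge_min lexx !orbT.
have r'd : r' < d.
  by rewrite !gt_min; apply/orP; right; apply/orP; right; lra.
(* The vertex moves so little that the maximum stays off the sphere. *)
pose s := Num.min r' ((k - nu) * r' / (4 * nu)).
have knu0 : 0 < k - nu by rewrite subr_gt0.
have nu4 : 0 < 4 * nu by rewrite mulr_gt0.
have s0 : 0 < s.
  by rewrite lt_min r'0 /=; apply: divr_gt0; exact: mulr_gt0.
have sr' : s <= r' by rewrite ge_min lexx.
have s_small : 4 * nu * s <= (k - nu) * r'.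
  have : s <= (k - nu) * r' / (4 * nu) by rewrite ge_min lexx orbT.
  by rewrite (ler_pdivlMr _ _ nu4) [s * _]mulrC.
have [y yx0] : exists y, enorm (y - x0) = s.
  exists (x0 + s *: basis_vec 0); rewrite addrAC subrr add0r enormZ.
  rewrite gtr0_norm // /enorm dotv_basis.
  by rewrite mxE !eqxx sqrtr1 mulr1.
have cpsi : {within [set z | enorm (z - x0) <= r'],
    continuous (fun z => v z + nu / 2 * enorm (z - y) ^+ 2)}.
  have cq : continuous (fun z : 'rV[R]_n.+1 => nu / 2 * enorm (z - y) ^+ 2).
    move=> z; apply: (@continuous_comp _ _ _
      (fun z : 'rV[R]_n.+1 => enorm (z - y)) (fun t => nu / 2 * t ^+ 2)).
      exact: continuous_enorm_dist.
    by apply: cvgM; [exact: cvg_cst|exact: exprn_continuous].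
  apply: (@continuous_subspaceW _ _ _ (closure Omega)) => [z zr|z].
    by apply/subset_closure/x0O; exact: le_trans zr r'r2.
  apply: cvgD; first exact: ultralimit_continuous.
  exact: (continuous_subspaceT cq).
have [|x /set_mem xr xm] := EVT_max_rV _ (@compact_enorm_ball _ _ x0 r') cpsi.
  by exists x0; rewrite /= subrr enorm0 ltW.
have {}xm z : enorm (z - x0) <= r' ->
    v z + nu / 2 * enorm (z - y) ^+ 2 <= v x + nu / 2 * enorm (x - y) ^+ 2.
  by move=> zr; exact/xm/mem_set.
rewrite /= in xr.
have Ox : Omega x by apply: x0O; exact: le_trans xr r'r2.
have x0r' : enorm (x0 - x0) <= r' by rewrite subrr enorm0 ltW.
have := xm _ x0r'; rewrite (enormB x0) yx0 => x0x.
have vkx := vk x (le_lt_trans xr r'r).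
have {vkx x0x} xr_lt : enorm (x - x0) < r'.
  rewrite lt_neqAle xr andbT; apply/eqP => xr'.
  have xy : enorm (x - y) <= r' + s.
    by have := enorm_triangle x x0 y; rewrite xr' (enormB x0) yx0.
  have xy2 : nu / 2 * enorm (x - y) ^+ 2 <= nu / 2 * (r' + s) ^+ 2.
    apply: ler_wpM2l; first by rewrite divr_ge0 // ltW.
    rewrite ler_pXn2r ?nnegrE ?enorm_ge0//.
    exact: le_trans (enorm_ge0 _) xy.
  rewrite xr' in vkx.
  have : 4 * nu * s * r' <= (k - nu) * r' * r' by rewrite ler_wpM2r // ltW.
  have : 0 < (k - nu) * r' * r' by rewrite !mulr_gt0 // subr_gt0.
  by lra.
have xy : x != y.
  apply/eqP => xy; have := xm _ x0r'.
  rewrite xy subrr enorm0 expr0n mulr0 addr0 (enormB x0) yx0.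
  have := vk y; rewrite yx0 => /(_ (le_lt_trans sr' r'r)).
  have : 0 < (nu + k) * s ^+ 2 by rewrite mulr_gt0 ?addr_gt0 // exprn_gt0.
  by lra.
pose A : 'M[R]_n.+1 := (- (mu / 2))%:M.
have QE h : quad_form A h = - (mu / 2) * enorm h ^+ 2.
  by rewrite /quad_form mul_mx_scalar dotvZl sqr_enorm.
pose b := nu *: y - (nu - mu) *: x.
have x_max : strict_local_max (v \- quad_poly 0 b A) x.
  apply/strict_local_max_enorm; exists (r' - enorm (x - x0)) => [|z zx zneqx].
    by rewrite subr_gt0.
  have zr : enorm (z - x0) <= r' by have := enorm_triangle z x x0; lra.
  have zx0 : 0 < (nu - mu) / 2 * enorm (z - x) ^+ 2.
    rewrite mulr_gt0 ?divr_gt0 ?subr_gt0 // exprn_gt0 // enorm_gt0 //.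
    by rewrite subr_eq0.
  have -> : (v \- quad_poly 0 b A) z = v z + nu / 2 * enorm (z - y) ^+ 2 -
      (nu - mu) / 2 * enorm (z - x) ^+ 2 - nu / 2 * enorm y ^+ 2 +
      (nu - mu) / 2 * enorm x ^+ 2.
    rewrite /= /quad_poly QE !sqr_enorm /b.
    rewrite !(dotvDl, dotvDr, dotvNl, dotvNr, dotvZl) (dotvC y z) (dotvC x z).
    by field.
  have -> : (v \- quad_poly 0 b A) x = v x + nu / 2 * enorm (x - y) ^+ 2 -
      nu / 2 * enorm y ^+ 2 + (nu - mu) / 2 * enorm x ^+ 2.
    rewrite /= /quad_poly QE !sqr_enorm /b.
    rewrite !(dotvDl, dotvDr, dotvNl, dotvNr, dotvZl) (dotvC y x).
    by field.
  by have := xm z zr; lra.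
have [e [_ pe Qe]] := ultralimit_touching Ox x_max.
have pE : b + x *m (A + A^T) = nu *: (y - x).
  rewrite /A tr_scalar_mx mulmxDr !mul_mx_scalar /b.
  by apply/rowP => i; rewrite !mxE; field.
have p0 : 0 < enorm (nu *: (y - x)).
  by rewrite enormZ gtr0_norm // mulr_gt0 // enorm_gt0 // subr_eq0 eq_sym.
have e1 : 1 <= enorm e.
  rewrite pE in pe; have := le_trans pe (dotv_le_enorm _ _).
  by rewrite ler_pMr.
have : mu <= mu * enorm e ^+ 2 by rewrite ler_pMr // exprn_ege1.
have xd : enorm (x - x0) < d by exact: lt_trans r'd.
have := fd x Ox xd; rewrite QE in Qe; rewrite ltr_norml.
by lra.
Qed.

Lemma ultralimit_subsolution phi x0 : poly_deg_le2 phi -> Omega x0 ->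
  strict_local_max (v \- phi) x0 -> - inf_laplacian_plus phi x0 <= f x0.
Proof.
move=> /poly_deg_le2E[c [b [A ->]]] Ox0 x0_max.
have [e [e1 pe Qe]] := ultralimit_touching Ox0 x0_max.
have [p pE] : exists p, p = b + x0 *m (A + A^T) by eexists.
rewrite /inf_laplacian_plus gradient_quad_poly -pE; rewrite -pE in pe.
have [p0|p0] := eqVneq p 0 => /=; last first.
  have np := enorm_gt0 p0.
  have eE : e = (enorm p)^-1 *: p.
    apply/eqP; rewrite -subr_eq0; apply/eqP/enorm_eq0/eqP.
    rewrite -sqrf_eq0 eq_le sqr_ge0 andbT sqr_enorm.
    rewrite !(dotvDl, dotvDr, dotvNl, dotvNr, dotvZl, dotvZr) (dotvC e p).
    rewrite -!sqr_enorm.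
    have -> : (enorm p)^-1 * ((enorm p)^-1 * enorm p ^+ 2) = 1.
      by field; rewrite gt_eqF.
    have : 1 <= (enorm p)^-1 * dotv p e by rewrite ler_pdivlMl // mulr1.
    have : enorm e ^+ 2 <= 1 by rewrite expr_le1 // enorm_ge0.
    by lra.
  rewrite eE quad_formZ in Qe; rewrite hess_form_quad_poly.
  by move: Qe; rewrite exprVn mulrCA.
set S := [set _ | _ in _]; pose lam := sup S.
have [C C0 QC] := quad_form_bound A.
have S_ub : has_ubound S.
  exists (2 * C) => _ [h h1 <-]; rewrite hess_form_quad_poly ler_wpM2l //.
  by have := QC h; rewrite h1 expr1n mulr1 ler_norml => /andP[].
have lamQ h : 2 * quad_form A h <= lam * enorm h ^+ 2.
  have [->|h0] := eqVneq h 0.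
    by rewrite enorm0 expr0n mulr0 /quad_form mul0mx dotv0l mulr0.
  have nh := enorm_gt0 h0.
  have : S (2 * quad_form A ((enorm h)^-1 *: h)).
    exists ((enorm h)^-1 *: h); last by rewrite hess_form_quad_poly.
    by rewrite /= enormZ gtr0_norm ?invr_gt0 // mulVf ?gt_eqF.
  move=> /(ub_le_sup S_ub); rewrite quad_formZ exprVn mulrCA.
  by rewrite ler_pdivrMl ?exprn_gt0 // [lam * _]mulrC.
(* If [lam] is nonnegative it does not matter that [e] may be shorter than a
   unit vector. *)
have [lam0|lam0] := leP 0 lam.
  have : lam * enorm e ^+ 2 <= lam.
    by rewrite -[leRHS]mulr1 ler_wpM2l // expr_le1 // enorm_ge0.
  by have := lamQ e; rewrite -/lam; lra.
have [r r0 v_max] := (strict_local_max_enorm _ _).1 x0_max.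
rewrite -/lam; apply: (@ultralimit_paraboloid x0 (- lam) r) => //.
  by rewrite oppr_gt0.
move=> x xr; have [->|xx0] := eqVneq x x0.
  by rewrite subrr enorm0 expr0n mulr0 subr0.
have := v_max x xr xx0; rewrite /= -{2}(subrK x0 x) [x - x0 + x0]addrC.
by rewrite quad_polyD -pE p0 dotv0l; have := lamQ (x - x0); lra.
Qed.

End UltralimitSubsolution.

(** * Uniform convergence *)

(** With this the supersolution property is the subsolution property of the
    opposite function. *)
Lemma inf_laplacian_quad_polyN (R : realType) (n : nat) (c : R)
    (b : 'rV[R]_n.+1) (A : 'M[R]_n.+1) x :
  inf_laplacian_plus (quad_poly (- c) (- b) (- A)) x =
  - inf_laplacian_minus (quad_poly c b A) x.
Proof.
have QN h : quad_form (- A) h = - quad_form A h.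
  by rewrite /quad_form mulmxN dotvNl.
rewrite /inf_laplacian_plus /inf_laplacian_minus !gradient_quad_poly.
have -> : - b + x *m (- A + (- A)^T) = - (b + x *m (A + A^T)).
  by rewrite linearN /= -opprD mulmxN opprD.
set p := b + _; rewrite oppr_eq0; case: ifPn => _.
  rewrite enormN !hess_form_quad_poly QN {1}/quad_form mulNmx dotvNl dotvNr.
  by rewrite opprK !mulrN.
rewrite /inf opprK; congr sup; rewrite image_comp.
by apply: eq_imagel => h _; rewrite /= !hess_form_quad_poly QN mulrN.
Qed.

Lemma strict_local_minN (R : realType) (n : nat) (h : 'rV[R]_n.+1 -> R) x :
  strict_local_min h x -> strict_local_max (\- h) x.
Proof. by apply: filterS => y; rewrite /= ltrN2. Qed.

Section Convergence.
Context {R : realType} {n : nat}.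
Variable Omega : set 'rV[R]_n.+1.
Hypothesis Omega_open : open Omega.
Hypothesis Omega_bounded : bounded_set Omega.
Variables (f g : 'rV[R]_n.+1 -> R).
Hypothesis f_cont : {within Omega, continuous f}.
Hypothesis f_bounded : [bounded f x | x in Omega].
Hypothesis g_cont : {within boundary Omega, continuous g}.
Variable W : R -> 'rV[R]_n.+1 -> R.
Hypothesis W_sol : forall eps, 0 < eps -> fd_solution Omega eps f g (W eps).

(** The convergence of [W eps x] to [v z] is uniform in [x] near [z], by
    equicontinuity; this is the form in which the limit is used. *)
Lemma ultralimit_exists (U : set_system R) : UltraFilter U ->
  (forall d, 0 < d -> U [set eps | 0 < eps < d]) ->
  exists v : 'rV[R]_n.+1 -> R, forall z eta, closure Omega z -> 0 < eta ->
    exists2 d, 0 < d & U [set eps | forall x, closure Omega x ->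
      enorm (x - z) < d -> `|W eps x - v z| < eta].
Proof.
move=> UU U0.
have [C WC] := uniform_bound Omega_open Omega_bounded f_bounded g_cont W_sol.
have lim x : exists l : R, closure Omega x -> W eps x @[eps --> U] --> l.
  have [cx|ncx] := pselect (closure Omega x); last by exists 0.
  have UC : U [set eps | `[- C, C]%classic (W eps x)].
    apply: filterS (U0 1 ltr01) => eps /andP[e0 e1].
    by rewrite /= in_itv /= -ler_norml WC // e0 ltW.
  have [l _ xl] := ultra_compact_cvg UU (@segment_compact _ (- C) C) UC.
  by exists l.
have [v vP] := choice lim; exists v => z eta cz eta0.
have eta2 : 0 < eta / 2 by rewrite divr_gt0.
have [d d0 Wd] := equicontinuity Omega_open Omega_bounded
  f_bounded g_cont W_sol cz eta2.
exists d => //; have /cvgrPdist_lt/(_ _ eta2) Wz := vP z cz.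
apply: filterS (filterI Wz (U0 d d0)) => eps /= [Wv e0d] x cx xz.
have := Wd eps e0d x cx xz; rewrite !ltr_norml in Wv *.
by lra.
Qed.

Lemma ultralimit_solution (U : set_system R) (v : 'rV[R]_n.+1 -> R) :
  UltraFilter U -> (forall d, 0 < d -> U [set eps | 0 < eps < d]) ->
  (forall z eta, closure Omega z -> 0 < eta ->
    exists2 d, 0 < d & U [set eps | forall x, closure Omega x ->
      enorm (x - z) < d -> `|W eps x - v z| < eta]) ->
  dirichlet_viscosity_solution Omega f g v.
Proof.
move=> UU U0 Wv; have cv := ultralimit_continuous UU Wv.
split=> //; last first.
  move=> x bx; apply/eqP; rewrite -subr_eq0 -normr_le0; apply/ler_addgt0Pl.
  move=> eta eta0; have [d d0 Wx] := Wv x eta bx.1 eta0.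
  have [eps [/andP[e0 _] /(_ x bx.1)]] := filter_ex (filterI (U0 1 ltr01) Wx).
  rewrite subrr enorm0 => /(_ d0); have [_ _ gw] := W_sol e0.
  by rewrite gw // addr0 distrC => /ltW.
split; first by apply: continuous_subspaceW cv; exact: subset_closure.
move=> phi x0 phi2 Ox0; split.
  exact: (ultralimit_subsolution Omega_open Omega_bounded f_cont W_sol
    UU U0 Wv).
move=> /strict_local_minN x0_max.
have [c [b [A phiE]]] := poly_deg_le2E phi2.
have NE : \- (v \- phi) = (\- v) \- quad_poly (- c) (- b) (- A).
  apply/funext => x; rewrite phiE /= /quad_poly /quad_form mulmxN !dotvNl.
  by ring.
rewrite NE in x0_max.
have Nf_cont : {within Omega, continuous (\- f)}.
  by move=> x; apply: continuousN; exact: f_cont.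
have NW_sol eps : 0 < eps -> fd_solution Omega eps (\- f) (\- g) (\- W eps).
  by move=> e0; apply: fd_solutionN; exact: W_sol.
have NWv z eta : closure Omega z -> 0 < eta ->
    exists2 d, 0 < d & U [set eps | forall x, closure Omega x ->
      enorm (x - z) < d -> `|(\- W eps) x - (\- v) z| < eta].
  move=> cz eta0; have [d d0 Wz] := Wv z eta cz eta0; exists d => //.
  apply: filterS Wz => eps /= Wz x cx xz.
  by rewrite -opprD normrN; exact: Wz.
have := ultralimit_subsolution Omega_open Omega_bounded Nf_cont NW_sol UU U0 NWv
  (quad_poly_deg_le2 _ _ _) Ox0 x0_max.
by rewrite inf_laplacian_quad_polyN opprK -phiE /= lerNr.
Qed.

(** Otherwise some [eta] is exceeded for arbitrarily small [eps], hence along an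
    ultrafilter; the ultralimit solves the boundary value problem, so it is [u],
    and equicontinuity makes the convergence uniform along the ultrafilter. *)
Lemma fd_solutions_cvg (u : 'rV[R]_n.+1 -> R) :
  {within closure Omega, continuous u} ->
  (forall v, dirichlet_viscosity_solution Omega f g v ->
    forall x, closure Omega x -> v x = u x) ->
  {uniform closure Omega, W eps @[eps --> 0^'+] --> u}.
Proof.
move=> cu u_uniq.
suff cvg_u eta : 0 < eta -> \forall eps \near 0^'+,
    forall x, closure Omega x -> `|W eps x - u x| < eta.
  move=> P /uniform_nbhs[E [+ EP]].
  rewrite -entourage_ballE => -[eta /= eta0 etaE].
  apply: filterS (cvg_u eta eta0) => eps Weps; apply: EP => x cx.
  by apply: etaE; rewrite /= /ball /= distrC; exact: Weps.
move=> eta0; pose good := [set eps | forall x, closure Omega x ->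
  `|W eps x - u x| < eta].
apply: contrapT => bad_near.
have bad_proper : ProperFilter (within (~` good) (0 : R)^'+).
  apply: Build_ProperFilter; rewrite /within /= => bad0; apply: bad_near.
  by apply: filterS bad0 => eps /= /contrapT.
have [U [UU subU]] := ultraFilterLemma bad_proper.
have U0 d : 0 < d -> U [set eps | 0 < eps < d].
  move=> d0; apply: subU; rewrite /within /=; near=> eps => _.
  apply/andP; split; first by near: eps; exact: nbhs_right_gt.
  by near: eps; exact: nbhs_right_lt.
have Ubad : U (~` good) by apply: subU; apply: withinT.
have [v Wv] := ultralimit_exists UU U0.
have vu := u_uniq v (ultralimit_solution UU U0 Wv).
have bad_point eps : exists x, ~ good eps ->
    closure Omega x /\ eta <= `|W eps x - u x|.
  have [geps|] := pselect (good eps); first by exists 0.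
  move=> /existsNP[x /not_implyP[cx /negP]]; rewrite -leNgt => Wx.
  by exists x.
have [X XP] := choice bad_point.
have UX : U [set eps | closure Omega (X eps)].
  by apply: filterS Ubad => eps /XP[].
have [x cx Xx] := ultra_compact_cvg UU (compact_closure Omega_bounded) UX.
have eta2 : 0 < eta / 2 by rewrite divr_gt0.
have [d1 d10 W1] := Wv x _ cx eta2.
have [d2 d20 u2] := (within_continuous_enorm _ _).1 cu x cx _ eta2.
have Ud : U [set eps | enorm (X eps - x) < Num.min d1 d2].
  apply: (Xx [set y | enorm (y - x) < Num.min d1 d2]); apply/nbhs_enorm.
  by exists (Num.min d1 d2); rewrite // lt_min d10.
have [eps [[W1e Xe] bade]] := filter_ex (filterI (filterI W1 Ud) Ubad).
have [cX] := XP eps bade; move: Xe; rewrite /= lt_min => /andP[Xd1 Xd2].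
have := W1e _ cX Xd1; have := u2 _ cX Xd2; rewrite vu //.
by rewrite !ltr_norml leNgt => ? ? /negP; apply; rewrite ltr_norml; lra.
Unshelve. all: by end_near. Qed.

End Convergence.

Unset Implicit Arguments.

Theorem corollary2p15 (R : realType) (n : nat) (Omega : set 'rV[R]_n.+1)
    (Omega_open : open Omega)
    (Omega_connected : connected Omega)
    (Omega_bounded : bounded_set Omega)
    (Omega_diam : (path_diam Omega < +oo)%E)
    (f : 'rV[R]_n.+1 -> R)
    (f_cont : {within Omega, continuous f})
    (f_bounded : [bounded f x | x in Omega])
    (g : 'rV[R]_n.+1 -> R)
    (g_cont : {within boundary Omega, continuous g})
    (u : 'rV[R]_n.+1 -> R)
    (u_sol : dirichlet_viscosity_solution Omega f g u)
    (u_unique : forall v : 'rV[R]_n.+1 -> R,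
       dirichlet_viscosity_solution Omega f g v ->
       forall x, closure Omega x -> v x = u x)
    (ubar uund : R -> 'rV[R]_n.+1 -> R)
    (ubar_max : forall eps : R, 0 < eps ->
       fd_maximal_solution Omega eps f g (ubar eps))
    (uund_min : forall eps : R, 0 < eps ->
       fd_minimal_solution Omega eps f g (uund eps)) :
  {uniform closure Omega, ubar eps @[eps --> 0^'+] --> u} /\
  {uniform closure Omega, uund eps @[eps --> 0^'+] --> u}.
Proof.
have [u_cont _ _] := u_sol; split; apply: (fd_solutions_cvg Omega_open
  Omega_bounded f_cont f_bounded g_cont _ u_cont u_unique) => eps eps0.
- by case: (ubar_max eps eps0).
- by case: (uund_min eps eps0).
Qed.
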